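(* Let $K$ be a compact subset of the unit circle $\mathbb{T}$ of arclength measure $0$ and let $L$ be a compact subset of the open unit disc $\mathbb{D}$. Let $\varphi: K\to\mathbb{C}$ be a continuous function with $\|\varphi\|_K\le 1$, and let $f$ be a holomorphic function on $\mathbb{D}$ with $\sup_{z\in\mathbb{D}}|f(z)|\le 1$. Let $\varepsilon>0$. Then there exists $r_0\in(0,1)$ such that, for any $r\in(r_0,1)$, there exists a finite Blaschke product $B$ such that $$\|B_r-\varphi\|_K<\varepsilon\quad\text{and}\quad \|B-f\|_L<\varepsilon,$$ where $B_r(z)=B(rz)$.
   Context: $\mathbb{D}$ is the open unit disc in $\mathbb{C}$ and $\mathbb{T}=\partial\mathbb{D}$. A finite Blaschke product is a function of the form $B(z)=\zeta\prod_{k=0}^{n}\frac{z-w_k}{1-\overline{w_k}z}$ with $w_0,\dots,w_n\in\mathbb{D}$ and $\zeta\in\mathbb{T}$. For $r\in(0,1)$, the dilate $B_r$ is the function $\overline{\mathbb{D}}\ni z\mapsto B(rz)$. For a compact set $E\subset\mathbb{C}$ and a continuous function $g$ on $E$, $\|g\|_E=\sup_{z\in E}|g(z)|$ (understood as $0$ if $E=\emptyset$). *)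

(* Defs.v *)
From HB Require Import structures.
From mathcomp Require Import all_boot all_order all_algebra.
From mathcomp Require Import all_classical all_reals all_analysis.
From mathcomp Require Import complex.

Set Implicit Arguments.
Unset Strict Implicit.
Unset Printing Implicit Defensive.

Import Order.TTheory GRing.Theory Num.Theory.
Import numFieldNormedType.Exports.

Local Open Scope classical_set_scope.
Local Open Scope ring_scope.
Local Open Scope complex_scope.

(* The complex numbers are R[i]^o: the regular-module alias of R[i] is what
   carries the topology and the normed-module structure over the field R[i].
   The norm `|z| takes its values in R[i], and z < 1 on R[i] means that z is
   real and less than 1; Normc.normc z is the modulus as an element of R. *)

Definition unit_disc (R : realType) : set R[i]^o := [set z | `|z| < 1].

Definition unit_circle (R : realType) : set R[i]^o := [set z | `|z| = 1].

Arguments unit_disc : clear implicits.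
Arguments unit_circle : clear implicits.

Definition arclength (R : realType) (E : set R[i]^o) : \bar R :=
  lebesgue_measure [set t : R | 0 <= t < 2 * pi /\ E (cos t +i* sin t)].

(* The modulus of g is bounded below by 0, so inserting 0 in the set only
   matters when E is empty, where it gives the value 0.  The supremum is taken
   in the extended reals, as sup in R is 0 on unbounded sets. *)
Definition supnorm (R : realType) (E : set R[i]^o) (g : R[i]^o -> R[i]^o) :
    \bar R :=
  ereal_sup ([set 0%E] `|` [set (Normc.normc (g z))%:E | z in E]).

(* Derivability is over the scalar field R[i], i.e. complex
   differentiability. *)
Definition holomorphic (R : realType) (U : set R[i]^o)
    (f : R[i]^o -> R[i]^o) : Prop :=
  forall z, U z -> derivable f z 1.

(* The poles 1 / (w k)^* lie outside the closed unit disc; the value there is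
   the junk one given by 0^-1 = 0. *)
Definition blaschke (R : realType) (zeta : R[i]^o) (n : nat)
    (w : 'I_n.+1 -> R[i]^o) (z : R[i]^o) : R[i]^o :=
  zeta * \prod_(k < n.+1) ((z - w k) / (1 - (w k)^* * z)).

Definition finite_blaschke_product (R : realType) (B : R[i]^o -> R[i]^o) :
    Prop :=
  exists (n : nat) (w : 'I_n.+1 -> R[i]^o) (zeta : R[i]^o),
    [/\ forall k, unit_disc R (w k), unit_circle R zeta & B = blaschke zeta w].

Definition dilate (R : realType) (r : R) (B : R[i]^o -> R[i]^o)
    (z : R[i]^o) : R[i]^o :=
  B (r%:C * z).

(* Main.v *)
(* By Pick interpolation at n nodes of the disc, a Schur function g is within
   2 prod |b_a| of a finite Blaschke product, where b_a are the Moebius factors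
   of the nodes; hence it suffices to find a Schur function g close to f on L and
   whose dilates are close to phi on K.  Cover K by finitely many discs with
   centres s_j on which phi is nearly constant, and, K having measure 0, by discs
   centred on the circle with radii d of arbitrarily small sum.  Sums F_j of
   M d / (1 + d - zeta^* z) over the discs (zeta, d) near s_j have nonnegative
   real part, are small away from s_j, and are large near the discs used.
   Composing with a rational map w of the half-plane into a half strip, g is the
   weighted average (A f + sum_j phi(s_j) w(F_j)) / (A + sum_j w(F_j)), up to a
   factor close to 1: since |w| <= Re w + 4, its modulus is at most 1 + o(1) as A
   grows.  As holomorphic means only complex differentiable, the Schwarz lemma
   behind Pick interpolation rests on Goursat's bisection, done in polar
   coordinates on Im (h dz / (z - c)). *)
Require Import Defs.
From HB Require Import structures.
From mathcomp Require Import all_boot all_order all_algebra.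
From mathcomp Require Import all_classical all_reals all_analysis.
From mathcomp Require Import complex.
From mathcomp Require Import ring lra.

Set Implicit Arguments.
Unset Strict Implicit.
Unset Printing Implicit Defensive.

Import Order.TTheory GRing.Theory Num.Theory.
Import numFieldNormedType.Exports.

Local Open Scope classical_set_scope.
Local Open Scope ring_scope.
Local Open Scope complex_scope.

(** The conflict to resolve is between modulus at most 1 on the whole disc and prescribed values
    near [K]. Nonnegative weights would give convex combinations, but nonconstant holomorphic
    weights cannot be real; bounding their imaginary parts while their real parts grow is the
    substitute. The constants avoid circularity by their order: the accuracy, then [A], then the
    size the weights must reach near [K], hence the height [M], and only then the discs covering
    [K]. Their radii sum to at most [D / M], so that at distance [D] the factor [M] is cancelled and
    the sums stay below 1. This is the only place where measure 0 enters. Neither [g] nor [r0]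
    depends on [r]; only the Blaschke product does, as it follows [g] on a closed disc whose radius
    must exceed [r]. Integrals over circles appear only as increments of real primitives. *)

Notation nrm := Normc.normc.
(* Both Num.conj and conjc are written ^* ; every ^* below is Num.conj. *)
Local Notation "x ^*" := (Num.conj x) : complex_scope.

(** * Modulus and conjugation of complex numbers *)

Section Modulus.
Variable R : realType.
Implicit Types (z w : R[i]) (x : R).

Lemma nrm_sq z : nrm z ^+ 2 = complex.Re z ^+ 2 + complex.Im z ^+ 2.
Proof. by case: z => a b /=; rewrite sqr_sqrtr // addr_ge0 // sqr_ge0. Qed.

Lemma nrm_ge0 z : 0 <= nrm z.
Proof. by case: z => a b /=; exact: sqrtr_ge0. Qed.

Lemma normE z : `|z| = (nrm z)%:C.
Proof. by case: z => a b; rewrite normc_def. Qed.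

Lemma nrmM z w : nrm (z * w) = nrm z * nrm w.
Proof. exact: Normc.normcM. Qed.

Lemma nrmV z : nrm z^-1 = (nrm z)^-1.
Proof. exact: Normc.normcV. Qed.

Lemma nrm0 : nrm (0 : R[i]) = 0.
Proof. exact: Normc.normc0. Qed.

Lemma nrm1 : nrm (1 : R[i]) = 1.
Proof. exact: Normc.normc1. Qed.

Lemma nrmN z : nrm (- z) = nrm z.
Proof. exact: normcN. Qed.

Lemma nrmD z w : nrm (z + w) <= nrm z + nrm w.
Proof. exact: le_normcD. Qed.

Lemma nrmB z w : nrm (z - w) <= nrm z + nrm w.
Proof. by rewrite (le_trans (nrmD _ _)) // nrmN. Qed.

Lemma nrmBC z w : nrm (z - w) = nrm (w - z).
Proof. by rewrite -nrmN opprB. Qed.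

Lemma nrm_tri w z v : nrm (z - v) <= nrm (z - w) + nrm (w - v).
Proof. by have := nrmD (z - w) (w - v); rewrite addrA subrK. Qed.

Lemma nrm_tri2 z w : nrm z - nrm w <= nrm (z - w).
Proof. by have := nrmD (z - w) w; rewrite subrK lerBlDr. Qed.

Lemma conjE z : z^* = conjc z.
Proof. by []. Qed.

Lemma conjK z : z^*^* = z.
Proof. by rewrite !conjE conjcK. Qed.

Lemma conjD z w : (z + w)^* = z^* + w^*.
Proof. by rewrite !conjE; case: z; case: w => a b c d /=; congr Complex; ring. Qed.

Lemma conjN z : (- z)^* = - z^*.
Proof. by rewrite !conjE; case: z. Qed.

Lemma conjM z w : (z * w)^* = z^* * w^*.
Proof. by rewrite !conjE; case: z; case: w => a b c d /=; congr Complex; ring. Qed.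

Lemma conj1 : (1 : R[i])^* = 1.
Proof. by rewrite conjE conjc1. Qed.

Lemma conj_eq0 z : (z^* == 0) = (z == 0).
Proof. by rewrite conjE conjc_eq0. Qed.

Lemma conjV z : (z^-1)^* = (z^*)^-1.
Proof. by rewrite !conjE conjc_inv. Qed.

Lemma conjX z n : (z ^+ n)^* = z^* ^+ n.
Proof. by elim: n => [|n IH]; rewrite ?expr0 ?conj1 // !exprS conjM IH. Qed.

Lemma nrmJ z : nrm z^* = nrm z.
Proof. by rewrite conjE; case: z => a b /=; rewrite sqrrN. Qed.

Lemma nrm_real x : nrm x%:C = `|x|.
Proof. by rewrite /= expr0n /= addr0 sqrtr_sqr. Qed.

Lemma nrm_real_ge0 x : 0 <= x -> nrm x%:C = x.
Proof. by move=> x0; rewrite nrm_real ger0_norm. Qed.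

Lemma nrm_eq0 z : (nrm z == 0) = (z == 0).
Proof.
apply/eqP/eqP => [|->]; last exact: nrm0.
by move=> h; exact: Normc.eq0_normc h.
Qed.

Lemma nrm_gt0 z : (0 < nrm z) = (z != 0).
Proof. by rewrite lt_def nrm_eq0 nrm_ge0 andbT. Qed.

Lemma nrm_le_abs x z : 0 <= x -> nrm z ^+ 2 <= x ^+ 2 -> nrm z <= x.
Proof. by move=> x0; rewrite ler_pXn2r // nnegrE ?nrm_ge0. Qed.

Lemma abs_Re_le z : `|complex.Re z| <= nrm z.
Proof. by have := normc_ge_Re z; rewrite normE lecR. Qed.

Lemma Re_le z : complex.Re z <= nrm z.
Proof. exact: le_trans (ler_norm _) (abs_Re_le z). Qed.

Lemma abs_Im_le z : `|complex.Im z| <= nrm z.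
Proof.
by case: z => a b /=; rewrite -sqrtr_sqr ler_wsqrtr // lerDr sqr_ge0.
Qed.

Lemma nrm_le_ReIm z : nrm z <= `|complex.Re z| + `|complex.Im z|.
Proof.
apply: nrm_le_abs; first by rewrite addr_ge0.
rewrite nrm_sq sqrrD !real_normK ?num_real // lerD2r lerDl.
by rewrite mulrn_wge0 // mulr_ge0.
Qed.

Lemma ReD z w : complex.Re (z + w) = complex.Re z + complex.Re w.
Proof. by case: z; case: w. Qed.

Lemma ImD z w : complex.Im (z + w) = complex.Im z + complex.Im w.
Proof. by case: z; case: w. Qed.

Lemma ReN z : complex.Re (- z) = - complex.Re z.
Proof. by case: z. Qed.

Lemma ImN z : complex.Im (- z) = - complex.Im z.
Proof. by case: z. Qed.

Lemma ReM z w : complex.Re (z * w) =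
  complex.Re z * complex.Re w - complex.Im z * complex.Im w.
Proof. by case: z; case: w. Qed.

Lemma ImM z w : complex.Im (z * w) =
  complex.Re z * complex.Im w + complex.Im z * complex.Re w.
Proof. by case: z => a b; case: w => c d. Qed.

Lemma Re_sum I (s : seq I) (P : pred I) (F : I -> R[i]) :
  complex.Re (\sum_(i <- s | P i) F i) = \sum_(i <- s | P i) complex.Re (F i).
Proof. exact: (big_morph _ ReD). Qed.

Lemma Im_sum I (s : seq I) (P : pred I) (F : I -> R[i]) :
  complex.Im (\sum_(i <- s | P i) F i) = \sum_(i <- s | P i) complex.Im (F i).
Proof. exact: (big_morph _ ImD). Qed.

Lemma nrm_sum I (s : seq I) (P : pred I) (F : I -> R[i]) :
  nrm (\sum_(i <- s | P i) F i) <= \sum_(i <- s | P i) nrm (F i).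
Proof.
elim/big_rec2: _ => [|i y z _ h]; first by rewrite nrm0.
by rewrite (le_trans (nrmD _ _)) // lerD2l.
Qed.

Lemma mulJ z : z * z^* = (nrm z ^+ 2)%:C.
Proof.
by rewrite conjE nrm_sq; case: z => a b; apply/eqP; rewrite eq_complex /=;
  apply/andP; split; apply/eqP; ring.
Qed.

Lemma ltc1 z : (`|z| < 1) = (nrm z < 1).
Proof. by rewrite normE ltcR. Qed.

Lemma eqc1 z : `|z| = 1 <-> nrm z = 1.
Proof.
rewrite normE; split => [/(congr1 (@complex.Re R)) //|-> //].
Qed.

End Modulus.

(** * Continuity and complex derivatives with real epsilons *)

Section EpsDelta.
Variable R : realType.
Implicit Types (h : R[i]^o -> R[i]^o) (z : R[i]^o).

Lemma nbhs_nrmP z (P : set R[i]^o) :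
  nbhs z P <-> exists2 d : R, 0 < d & forall w, nrm (w - z) < d -> P w.
Proof.
rewrite nbhs_ballP; split => -[d d0 dP].
  (* A positive element of [R[i]] is real, so the real part is the radius itself. *)
  exists (complex.Re d).
    move: d0; rewrite /= ltcE /=. by move=> /andP[].
  move=> w wd; apply: (dP w); rewrite /ball /= distrC normE.
  by move: d0; rewrite /= !ltcE /= wd andbT eq_sym => /andP[].
exists d%:C; first by rewrite /= ltcR.
move=> w; rewrite /ball /= distrC normE ltcR; exact: dP.
Qed.

Lemma cts_epsP h z : {for z, continuous h} <->
  forall e : R, 0 < e -> exists2 d : R, 0 < d &
    forall w, nrm (w - z) < d -> nrm (h w - h z) < e.
Proof.
split => [hc e e0|H A].
  have /hc/nbhs_nrmP[d d0 dP] : nbhs (h z) [set y : R[i]^o | nrm (y - h z) < e].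
    by apply/nbhs_nrmP; exists e.
  by exists d.
move=> /nbhs_nrmP[e e0 eA]; have [d d0 dH] := H e e0.
by apply/nbhs_nrmP; exists d => // w /dH /eA.
Qed.

Lemma ctsR_epsP (u : R[i]^o -> R) z : {for z, continuous u} <->
  forall e : R, 0 < e -> exists2 d : R, 0 < d &
    forall w, nrm (w - z) < d -> `|u w - u z| < e.
Proof.
split => [hc e e0|H A].
  have /hc/nbhs_nrmP[d d0 dP] : nbhs (u z) (ball (u z) e) by exact: nbhsx_ballx.
  by exists d => // w /dP; rewrite /= /ball /= distrC.
move=> /nbhs_ballP[e e0 eA]; have [d d0 dH] := H e e0.
apply/nbhs_nrmP; exists d => // w /dH we; apply: eA.
by rewrite /ball /= distrC.
Qed.

Lemma cts_Re : continuous (fun z : R[i]^o => complex.Re z).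
Proof.
move=> z; apply/ctsR_epsP => e e0; exists e => // w.
by apply: le_lt_trans; rewrite -ReN -ReD abs_Re_le.
Qed.

Lemma cts_Im : continuous (fun z : R[i]^o => complex.Im z).
Proof.
move=> z; apply/ctsR_epsP => e e0; exists e => // w.
by apply: le_lt_trans; rewrite -ImN -ImD abs_Im_le.
Qed.

Lemma cts_nrm : continuous (fun z : R[i]^o => nrm z).
Proof.
move=> z; apply/ctsR_epsP => e e0; exists e => // w.
apply: le_lt_trans; rewrite ler_norml nrm_tri2 andbT.
by have := nrm_tri2 z w; rewrite nrmBC lerNl opprB.
Qed.

Lemma cts_pair (T : topologicalType) (a b : T -> R) (t : T) :
  {for t, continuous a} -> {for t, continuous b} ->
  {for t, continuous (fun s => (a s +i* b s : R[i]^o))}.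
Proof.
move=> ca cb A /nbhs_nrmP[e e0 eA].
have e2 : 0 < e / 2 by rewrite divr_gt0.
have /ca Ha : nbhs (a t) (ball (a t) (e / 2)) by exact: nbhsx_ballx.
have /cb Hb : nbhs (b t) (ball (b t) (e / 2)) by exact: nbhsx_ballx.
near=> s; apply: eA.
apply: le_lt_trans (nrm_le_ReIm _) _.
rewrite ReD ReN ImD ImN /= [e]splitr ltrD // distrC.
  by near: s.
by near: s.
Unshelve. all: by end_near. Qed.

Lemma compact_disc (r : R) : compact [set z : R[i]^o | nrm z <= r].
Proof.
have cs : compact ((fun p : R * R => (p.1 +i* p.2 : R[i]^o)) @`
    (`[- r, r] `*` `[- r, r])).
  apply: continuous_compact; last by apply: compact_setX; exact: segment_compact.
  apply: continuous_subspaceT => p.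
  apply: cts_pair; [exact: cvg_fst|exact: cvg_snd].
apply: (subclosed_compact _ cs).
  have := @closed_comp _ _ (fun z : R[i]^o => nrm z) [set x | x <= r]
    (fun z _ => @cts_nrm z) (@closed_le R r).
  exact.
move=> z /= zr; exists (complex.Re z, complex.Im z); last by case: z {zr}.
have h1 := le_trans (abs_Re_le z) zr; have h2 := le_trans (abs_Im_le z) zr.
by split => /=; rewrite in_itv /= -ler_norml.
Qed.

Lemma derivable_epsP h z : derivable h z 1 -> exists D : R[i], forall e : R,
  0 < e -> exists2 d : R, 0 < d & forall w, nrm (w - z) < d ->
    nrm (h w - h z - D * (w - z)) <= e * nrm (w - z).
Proof.
move=> /cvg_ex[/= D HD]; exists D => e e0.
have /HD : nbhs D [set y | nrm (y - D) < e] by apply/nbhs_nrmP; exists e.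
rewrite /nbhs /= /dnbhs /within /= => /nbhs_nrmP[d d0 dH].
exists d => // w wd; have [->|wz] := eqVneq w z.
  by rewrite !subrr mulr0 subrr nrm0 mulr0.
have wz0 : w - z != 0 by rewrite subr_eq0.
have := dH (w - z); rewrite subr0 wd => /(_ isT wz0).
rewrite /= /GRing.scale /= mulr1 subrK => /ltW H.
have -> : h w - h z - D * (w - z) =
    ((w - z)^-1 * (h w - h z) - D) * (w - z) by field.
by rewrite nrmM ler_wpM2r // nrm_ge0.
Qed.

Lemma derivable_cts h z : derivable h z 1 -> {for z, continuous h}.
Proof. by move=> /derivable1_diffP /differentiable_continuous. Qed.

End EpsDelta.

(** * Real primitives and nested intervals *)

Section Primitives.
Variable R : realType.
Implicit Types (f A V : R -> R).

Lemma exists_primitive f (a : R) : continuous f ->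
  exists A, forall x, a < x -> is_derive x 1 A (f x).
Proof.
move=> fc; exists (fun x => \int[lebesgue_measure]_(t in `[a, x]) f t)%R => x ax.
have xx : x < x + 1 by rewrite ltrDl.
have fi : lebesgue_measure.-integrable `[a, x + 1] (EFin \o f).
  apply: continuous_compact_integrable; first exact: segment_compact.
  exact: continuous_subspaceT.
have [d e] := continuous_FTC1_closed xx fi ax (fc x).
by rewrite -e derive1E; exact: DeriveDef.
Qed.

(** Mean value theorem for [A] minus the quadratic primitive of the affine model. It integrates the
    model along a side of a cell with a controlled error; with [k0 = k1 = 0] it becomes a Lipschitz
    bound. *)
Lemma increment_affine_approx A V (a b c k0 k1 eta : R) : a <= b ->
  (forall x, a <= x <= b -> is_derive x 1 A (V x)) ->
  (forall x, a <= x <= b -> `|V x - (k0 + k1 * (x - c))| <= eta) ->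
  `|A b - A a - (k0 * (b - a) + k1 * ((b - c) ^+ 2 - (a - c) ^+ 2) / 2)|
    <= eta * (b - a).
Proof.
move=> ab dA bV.
pose G x := A x - (k0 * x + k1 / 2 * (x - c) ^+ 2).
have dG x : a <= x <= b -> is_derive x 1 G (V x - (k0 + k1 * (x - c))).
  move=> /dA dAx; rewrite /G.
  have d1 : is_derive x 1 (fun y : R => k0 * y + k1 / 2 * (y - c) ^+ 2)
      (k0 + k1 * (x - c)).
    have d2 : is_derive x 1 (fun y : R => y - c) (1 - 0).
      exact: (is_deriveB (is_derive_id _ _) (is_derive_cst _ _ _)).
    have d3 := is_deriveD (is_deriveZ k0 (is_derive_id x 1))
      (is_deriveZ (k1 / 2) (is_deriveX 2 d2)).
    by apply: (is_derive_eq d3); rewrite /GRing.scale /=; field.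
  exact: (is_deriveB dAx d1).
have Gc : {within `[a, b], continuous G}.
  apply: derivable_within_continuous => x; rewrite in_itv /= => xab.
  by have [] := dG x xab.
have dG' x : x \in `]a, b[ -> is_derive x 1 G (V x - (k0 + k1 * (x - c))).
  by move=> /subset_itv_oo_cc; rewrite in_itv /=; exact: dG.
have [x xab e] := MVT_segment ab dG' Gc.
have -> : A b - A a - (k0 * (b - a) + k1 * ((b - c) ^+ 2 - (a - c) ^+ 2) / 2)
    = G b - G a by rewrite /G; field.
rewrite e normrM [`|b - a|]ger0_norm ?subr_ge0 // ler_wpM2r ?subr_ge0 //.
by apply: bV; move: xab; rewrite in_itv.
Qed.

Lemma nested_intervals (x w : nat -> R) : (forall n, 0 <= w n) ->
  (forall n, x n <= x n.+1) -> (forall n, x n.+1 + w n.+1 <= x n + w n) ->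
  exists c, forall n, x n <= c <= x n + w n.
Proof.
move=> w0 xS yS.
have xm m n : (m <= n)%N -> x m <= x n.
  move=> /subnK <-; elim: (n - m)%N => // k IH.
  by rewrite addSn (le_trans IH).
have ym m n : (m <= n)%N -> x n + w n <= x m + w m.
  move=> /subnK <-; elim: (n - m)%N => // k IH.
  by rewrite addSn (le_trans (yS _)).
have xy m n : x m <= x n + w n.
  case: (leqP m n) => [|/ltnW] h.
    by rewrite (le_trans (xm _ _ h)) // lerDl.
  by rewrite (le_trans _ (ym _ _ h)) // lerDl.
exists (sup (range x)) => n; apply/andP; split.
  apply: ub_le_sup; last by exists n.
  by exists (x 0%N + w 0%N) => _ [m _ <-].
apply: ge_sup; first by exists (x 0%N), 0%N.
by move=> _ [m _ <-].
Qed.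

End Primitives.

(** * Goursat's theorem on a rectangle *)

Section Goursat.
Variable R : realType.
Variables (U V A B : R -> R -> R) (a b sx sy : R).
Hypotheses (sx0 : 0 < sx) (sy0 : 0 < sy).
Hypothesis dA : forall t x, a <= x <= a + sx -> is_derive x 1 (A t) (V x t).
Hypothesis dB : forall x t : R, a <= x <= a + sx -> b <= t <= b + sy ->
  is_derive t 1 (B x) (U x t).
(* The Cauchy-Riemann equations at (x0, t0), with complex derivative p + i q. *)
Hypothesis dUV : forall x0 t0, a <= x0 <= a + sx -> exists p q : R,
  forall e, 0 < e -> exists2 d : R, 0 < d &
    forall x t, `|x - x0| < d -> `|t - t0| < d ->
      `|U x t - (U x0 t0 + p * (x - x0) - q * (t - t0))|
        <= e * (`|x - x0| + `|t - t0|) /\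
      `|V x t - (V x0 t0 + q * (x - x0) + p * (t - t0))|
        <= e * (`|x - x0| + `|t - t0|).

(** Counterclockwise boundary integral of [V dx + U dt], that is of the imaginary part of
    [(U + i V) (dx + i dt)], over the cell with lower left corner [c] and sides [w], [h]. *)
Let I (c : R * R) (w h : R) :=
  (A c.2 (c.1 + w) - A c.2 c.1) + (B (c.1 + w) (c.2 + h) - B (c.1 + w) c.2)
  - (A (c.2 + h) (c.1 + w) - A (c.2 + h) c.1) - (B c.1 (c.2 + h) - B c.1 c.2).

Let w n : R := sx / 2 ^+ n.
Let h n : R := sy / 2 ^+ n.

Let w0 n : 0 < w n. Proof. by rewrite divr_gt0 // exprn_gt0. Qed.
Let h0 n : 0 < h n. Proof. by rewrite divr_gt0 // exprn_gt0. Qed.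
Let wS n : w n = w n.+1 + w n.+1.
Proof. by rewrite /w exprS; field; rewrite expf_neq0. Qed.
Let hS n : h n = h n.+1 + h n.+1.
Proof. by rewrite /h exprS; field; rewrite expf_neq0. Qed.

(** Picks a quarter carrying at least a fourth of the integral. The upper right quarter is the
    default: if the other three fail, additivity of [I] forces it to qualify. *)
Let step (c : R * R) n : R * R :=
  let big c' := `|I c (w n) (h n)| <= 4 * `|I c' (w n.+1) (h n.+1)| in
  if big c then c
  else if big (c.1 + w n.+1, c.2) then (c.1 + w n.+1, c.2)
  else if big (c.1, c.2 + h n.+1) then (c.1, c.2 + h n.+1)
  else (c.1 + w n.+1, c.2 + h n.+1).

Let stepP c n :
  [/\ `|I c (w n) (h n)| <= 4 * `|I (step c n) (w n.+1) (h n.+1)|,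
      c.1 <= (step c n).1 <= c.1 + w n.+1 &
      c.2 <= (step c n).2 <= c.2 + h n.+1].
Proof.
have wn := w0 n.+1; have hn := h0 n.+1.
have e : I c (w n) (h n) = I c (w n.+1) (h n.+1)
    + I (c.1 + w n.+1, c.2) (w n.+1) (h n.+1)
    + I (c.1, c.2 + h n.+1) (w n.+1) (h n.+1)
    + I (c.1 + w n.+1, c.2 + h n.+1) (w n.+1) (h n.+1).
  by rewrite /I wS hS /= !addrA; ring.
rewrite /step.
case: ifPn => [|h1]; first by split => //; lra.
case: ifPn => [|h2] /=; first by split => //; lra.
case: ifPn => [|h3] /=; first by split => //; lra.
rewrite -ltNge in h1; rewrite -ltNge in h2; rewrite -ltNge in h3.
split; [|lra|lra].
rewrite leNgt; apply/negP => h4.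
have := ler_normD (I c (w n.+1) (h n.+1)
    + I (c.1 + w n.+1, c.2) (w n.+1) (h n.+1)
    + I (c.1, c.2 + h n.+1) (w n.+1) (h n.+1))
  (I (c.1 + w n.+1, c.2 + h n.+1) (w n.+1) (h n.+1)).
have := ler_normD (I c (w n.+1) (h n.+1)
    + I (c.1 + w n.+1, c.2) (w n.+1) (h n.+1))
    (I (c.1, c.2 + h n.+1) (w n.+1) (h n.+1)).
have := ler_normD (I c (w n.+1) (h n.+1))
    (I (c.1 + w n.+1, c.2) (w n.+1) (h n.+1)).
rewrite -e; lra.
Qed.

Let cell := fix cell n := if n is m.+1 then step (cell m) m else (a, b).

Let I_cell n : `|I (a, b) sx sy| <= 4 ^+ n * `|I (cell n) (w n) (h n)|.
Proof.
elim: n => [|n IH]; first by rewrite /w /h !expr0 !divr1 mul1r.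
have [s _ _] := stepP (cell n) n.
by rewrite (le_trans IH) // exprSr -mulrA ler_wpM2l // exprn_ge0.
Qed.

(** The affine model contributes nothing: opposite sides have equal [q] terms, and the [p] terms of
    the vertical sides cancel those of the horizontal ones. Only the error [eta] times the perimeter
    remains. *)
Let I_small c n x0 t0 p q e : 0 <= e -> a <= c.1 -> c.1 + w n <= a + sx ->
  b <= c.2 -> c.2 + h n <= b + sy ->
  c.1 <= x0 <= c.1 + w n -> c.2 <= t0 <= c.2 + h n ->
  (forall x t, c.1 <= x <= c.1 + w n -> c.2 <= t <= c.2 + h n ->
      `|U x t - (U x0 t0 + p * (x - x0) - q * (t - t0))|
        <= e * (`|x - x0| + `|t - t0|) /\
      `|V x t - (V x0 t0 + q * (x - x0) + p * (t - t0))|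
        <= e * (`|x - x0| + `|t - t0|)) ->
  `|I c (w n) (h n)| <= 2 * e * (w n + h n) ^+ 2.
Proof.
move=> e0 ac cs bc ct x0c t0c UV; have wn := w0 n; have hn := h0 n.
set eta := e * (w n + h n).
have bnd x t : c.1 <= x <= c.1 + w n -> c.2 <= t <= c.2 + h n ->
    e * (`|x - x0| + `|t - t0|) <= eta.
  by move=> xc tc; rewrite ler_wpM2l // lerD // ler_norml; lra.
have c2c : c.2 <= c.2 <= c.2 + h n by lra.
have c2h : c.2 <= c.2 + h n <= c.2 + h n by lra.
have c1c : c.1 <= c.1 <= c.1 + w n by lra.
have c1w : c.1 <= c.1 + w n <= c.1 + w n by lra.
have hA t : c.2 <= t <= c.2 + h n -> `|A t (c.1 + w n) - A t c.1 -
    ((V x0 t0 + p * (t - t0)) * (c.1 + w n - c.1) +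
     q * ((c.1 + w n - x0) ^+ 2 - (c.1 - x0) ^+ 2) / 2)|
     <= eta * (c.1 + w n - c.1).
  move=> tc; apply: (@increment_affine_approx _ (A t) (fun x => V x t)).
  - lra.
  - by move=> x xc; apply: dA; lra.
  - move=> x xc; have [_ v] := UV _ _ xc tc.
    by rewrite (_ : V x0 t0 + _ + _ = V x0 t0 + q * (x - x0) + p * (t - t0));
      [exact: le_trans v (bnd _ _ xc tc)|ring].
have hB x : c.1 <= x <= c.1 + w n -> `|B x (c.2 + h n) - B x c.2 -
    ((U x0 t0 + p * (x - x0)) * (c.2 + h n - c.2) +
     (- q) * ((c.2 + h n - t0) ^+ 2 - (c.2 - t0) ^+ 2) / 2)|
     <= eta * (c.2 + h n - c.2).
  move=> xc; apply: (@increment_affine_approx _ (B x) (fun t => U x t)).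
  - lra.
  - by move=> t tc; apply: dB; [lra|lra].
  - move=> t tc; have [v _] := UV _ _ xc tc.
    by rewrite (_ : U x0 t0 + _ + _ = U x0 t0 + p * (x - x0) - q * (t - t0));
      [exact: le_trans v (bnd _ _ xc tc)|ring].
move: (hA _ c2c) (hA _ c2h) (hB _ c1c) (hB _ c1w).
have -> : 2 * e * (w n + h n) ^+ 2 =
    eta * (c.1 + w n - c.1) + eta * (c.2 + h n - c.2)
    + (eta * (c.1 + w n - c.1) + eta * (c.2 + h n - c.2)).
  by rewrite /eta; ring.
rewrite !ler_norml /I; nra.
Qed.

Lemma rectangle_integral_eq0 :
  (A b (a + sx) - A b a) + (B (a + sx) (b + sy) - B (a + sx) b)
  - (A (b + sy) (a + sx) - A (b + sy) a) - (B a (b + sy) - B a b) = 0.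
Proof.
change (I (a, b) sx sy = 0).
have [x0 Hx] : exists c, forall n, (cell n).1 <= c <= (cell n).1 + w n.
  apply: nested_intervals => n; first exact: ltW.
    by have [_ /andP[]] := stepP (cell n) n.
  by rewrite [w n]wS addrA lerD2r; have [_ /andP[]] := stepP (cell n) n.
have [t0 Ht] : exists c, forall n, (cell n).2 <= c <= (cell n).2 + h n.
  apply: nested_intervals => n; first exact: ltW.
    by have [_ _ /andP[]] := stepP (cell n) n.
  by rewrite [h n]hS addrA lerD2r; have [_ _ /andP[]] := stepP (cell n) n.
have cb n : [/\ a <= (cell n).1, (cell n).1 + w n <= a + sx,
    b <= (cell n).2 & (cell n).2 + h n <= b + sy].
  elim: n => [|n [h1 h2 h3 h4]] /=; first by rewrite /w /h expr0 !divr1.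
  have [_ /andP[? ?] /andP[? ?]] := stepP (cell n) n.
  have ws := wS n; have hs := hS n; rewrite -/cell; split; lra.
have x0a : a <= x0 <= a + sx by have [? ? _ _] := cb 0%N; have := Hx 0%N; lra.
have [p [q Hpq]] := dUV t0 x0a.
have key e : 0 < e -> `|I (a, b) sx sy| <= e * (2 * (sx + sy) ^+ 2).
  move=> e0; have [d d0 Hd] := Hpq e e0.
  have [n nd] : exists n, w n < d /\ h n < d.
    have [n Hn] : exists n : nat, (sx + sy) / d < n%:R.
      by exists (Num.bound ((sx + sy) / d)); apply: archi_boundP;
        rewrite divr_ge0 // ?addr_ge0 // ltW.
    have Hn2 : n%:R <= 2 ^+ n :> R by rewrite -natrX ler_nat ltnW // ltn_expl.
    have p2 : 0 < 2 ^+ n :> R by rewrite exprn_gt0.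
    have : sx + sy < 2 ^+ n * d.
      by rewrite -ltr_pdivrMr //; exact: lt_le_trans Hn Hn2.
    by move=> sd; exists n; rewrite /w /h !ltr_pdivrMr // ![d * _]mulrC;
      split; apply: lt_trans sd; rewrite ?ltrDl ?ltrDr.
  have [ca cs cb' ct] := cb n.
  have := @I_small (cell n) n x0 t0 p q e (ltW e0) ca cs cb' ct (Hx n) (Ht n).
  have Hxn := Hx n; have Htn := Ht n.
  case: nd => nd1 nd2 /(_ _) H.
  have {}H : `|I (cell n) (w n) (h n)| <= 2 * e * (w n + h n) ^+ 2.
    by apply: H => x t xc tc; apply: Hd; rewrite ltr_norml; lra.
  rewrite (le_trans (I_cell n)) //.
  (* The factor [4 ^+ n] cancels exactly against the squared side lengths, so the bound is
     independent of the depth. *)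
  have -> : e * (2 * (sx + sy) ^+ 2) = 4 ^+ n * (2 * e * (w n + h n) ^+ 2).
    rewrite /w /h (_ : 4 = 2 ^+ 2 :> R) -?exprM ?[(2 * n)%N]mulnC; last by ring.
    by rewrite exprM; field; rewrite expf_neq0.
  by rewrite ler_wpM2l // exprn_ge0.
apply/eqP; rewrite -normr_eq0 eq_le normr_ge0 andbT.
apply/ler_addgt0Pl => e e0; rewrite addr0.
have s0 : 0 < 2 * (sx + sy) ^+ 2 by rewrite mulr_gt0 // exprn_gt0 // addr_gt0.
have := key (e / (2 * (sx + sy) ^+ 2)) (divr_gt0 e0 s0).
by rewrite divfK // gt_eqF.
Qed.

End Goursat.

(** * Polar coordinates and the Cauchy-Riemann equations *)

Section CircleMean.
Variable R : realType.

Lemma is_derive_eps (f : R -> R) (x l : R) : is_derive x 1 f l ->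
  forall e : R, 0 < e -> exists2 d : R, 0 < d & forall y, `|y - x| < d ->
    `|f y - f x - l * (y - x)| <= e * `|y - x|.
Proof.
move=> [/cvg_ex[/= D HD] Dl] e e0.
have {Dl} Dl : D = l by rewrite -Dl; apply/esym/cvg_lim.
rewrite Dl in HD.
have /HD : nbhs l (ball l e) by exact: nbhsx_ballx.
rewrite /nbhs /= /dnbhs /within /= => -[d /= d0 dH].
exists d => // y yd; have [->|yx] := eqVneq y x.
  by rewrite !subrr mulr0 subrr normr0 mulr0.
have yx0 : y - x != 0 by rewrite subr_eq0.
have := dH (y - x); rewrite /= sub0r normrN yd => /(_ isT yx0).
rewrite /ball /= /GRing.scale /= mulr1 subrK distrC => /ltW H.
have -> : f y - f x - l * (y - x) =
    ((y - x)^-1 * (f y - f x) - l) * (y - x) by field.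
by rewrite normrM ler_wpM2r.
Qed.

(** This is [exp (x + i t)]. With [z = c + polar x t], circles about [c] become segments of constant
    [x], an annulus becomes a rectangle, and [dz / (z - c)] becomes [dx + i dt]. *)
Definition polar (x t : R) : R[i] := (expR x * cos t) +i* (expR x * sin t).

Lemma polarD x u t v : polar (x + u) (t + v) = polar x t * polar u v.
Proof.
rewrite /polar expRD cosD sinD; apply/eqP; rewrite eq_complex /=.
by apply/andP; split; apply/eqP; ring.
Qed.

Lemma nrm_polar x t : nrm (polar x t) = expR x.
Proof.
apply/eqP; rewrite -(eqrXn2 (n := 2)) ?nrm_ge0 ?expR_ge0 // nrm_sq /=.
by rewrite !exprMn -mulrDr cos2Dsin2 mulr1.
Qed.

Lemma polar_expansion (e : R) : 0 < e -> exists2 d : R, 0 < d &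
  forall u v, `|u| < d -> `|v| < d ->
    nrm (polar u v - 1 - (u +i* v)) <= e * (`|u| + `|v|).
Proof.
move=> e0; pose k := Num.min (1 / 2) (e / 6).
have k0 : 0 < k by rewrite lt_min !divr_gt0.
have k2 : k <= 1 / 2 by rewrite ge_min lexx.
have ke : k <= e / 6 by rewrite ge_min lexx orbT.
clearbody k.
have [d1 d10 H1] := is_derive_eps (is_derive_expR 0) k0.
have [d2 d20 H2] := is_derive_eps (is_derive_sin 0) k0.
have [d3 d30 H3] := is_derive_eps (is_derive_cos 0) k0.
exists (Num.min k (Num.min d1 (Num.min d2 d3))).
  by rewrite !lt_min k0 d10 d20 d30.
move=> u v; rewrite !lt_min => /and4P[uk u1 u2 u3] /and4P[vk v1 v2 v3].
have := H1 u; rewrite expR0 mul1r !subr0 => /(_ u1) h1.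
have := H2 v; rewrite sin0 cos0 mul1r !subr0 => /(_ v2) h2.
have := H3 v; rewrite !subr0 sin0 cos0 oppr0 mul0r subr0 => /(_ v3) h3.
have a1 : `|expR u - 1| <= 3 / 2 * `|u|.
  rewrite (_ : expR u - 1 = (expR u - 1 - u) + u); last by ring.
  by rewrite (le_trans (ler_normD _ _)) //; have := normr_ge0 u; nra.
have a2 : expR u <= 2 by have := ler_norm (expR u - 1); lra.
have a0 := expR_ge0 u.
apply: le_trans (nrm_le_ReIm _) _; rewrite !ReD !ImD !ReN !ImN /=.
rewrite (_ : _ - 1 - u = expR u * (cos v - 1) + (expR u - 1 - u)); last by ring.
rewrite (_ : _ - 0 - v = expR u * (sin v - v) + (expR u - 1) * v); last by ring.
have b1 := ler_normD (expR u * (cos v - 1)) (expR u - 1 - u).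
have b2 := ler_normD (expR u * (sin v - v)) ((expR u - 1) * v).
rewrite !normrM (ger0_norm a0) in b1 b2.
have c1 : expR u * `|cos v - 1| <= 2 * (k * `|v|) by rewrite ler_pM.
have c2 : expR u * `|sin v - v| <= 2 * (k * `|v|) by rewrite ler_pM.
have c3 : `|expR u - 1| * `|v| <= 3 / 2 * k * `|v|.
  by rewrite ler_wpM2r // (le_trans a1) // ler_wpM2l // ltW.
have c4 : k * `|v| <= e / 6 * `|v| by rewrite ler_wpM2r.
have c5 : k * `|u| <= e / 6 * `|u| by rewrite ler_wpM2r.
have c6 : 0 <= e / 6 * `|u| by rewrite mulr_ge0 // divr_ge0 // ltW.
have c7 : 0 <= e / 6 * `|v| by rewrite mulr_ge0 // divr_ge0 // ltW.
nra.
Qed.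

Lemma increment_le (A V : R -> R) (a b k : R) : a <= b ->
  (forall x, a <= x <= b -> is_derive x 1 A (V x)) ->
  (forall x, a <= x <= b -> V x <= k) -> A b - A a <= k * (b - a).
Proof.
move=> ab dA Vk.
have dA' x : x \in `]a, b[ -> is_derive x 1 A (V x).
  by move=> /subset_itv_oo_cc; rewrite in_itv /=; exact: dA.
have Ac : {within `[a, b], continuous A}.
  apply: derivable_within_continuous => x; rewrite in_itv /= => xab.
  by have [] := dA x xab.
have [x xab ->] := MVT_segment ab dA' Ac.
by rewrite ler_wpM2r ?subr_ge0 //; apply: Vk; move: xab; rewrite in_itv.
Qed.

(** Chain rule: the derivative is [D * P0], since [polar] is its own complex derivative. *)
Lemma polar_cauchy_riemann (h : R[i]^o -> R[i]^o) (c : R[i]) (x0 t0 : R) :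
  derivable h (c + polar x0 t0) 1 ->
  exists p q : R, forall e, 0 < e -> exists2 d : R, 0 < d &
    forall x t, `|x - x0| < d -> `|t - t0| < d ->
      nrm (h (c + polar x t) - h (c + polar x0 t0)
        - (p +i* q) * ((x - x0) +i* (t - t0)))
      <= e * (`|x - x0| + `|t - t0|).
Proof.
set P0 := polar x0 t0 => /derivable_epsP[D HD].
exists (complex.Re (D * P0)), (complex.Im (D * P0)) => e e0.
have -> : (complex.Re (D * P0) +i* complex.Im (D * P0)) = D * P0 by case: (D * P0).
have n0 : 0 < nrm P0 by rewrite nrm_polar expR_gt0.
(* By [nP] below an increment of [polar] is at most [3 * nrm P0] times that of the coordinates, so
   this costs [e / 2]; the other half pays for the term [D * P0 * E]. *)
have e10 : 0 < e / 6 / nrm P0 by rewrite !divr_gt0.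
have [d1 d10 H1] := HD _ e10.
pose k := Num.min 1 (e / 2 / (nrm (D * P0) + 1)).
have m0 : 0 < nrm (D * P0) + 1 by rewrite ltr_wpDl // nrm_ge0.
have k0 : 0 < k by rewrite lt_min !divr_gt0 // ltr01.
have k1 : k <= 1 by rewrite ge_min lexx.
have ke : nrm (D * P0) * k <= e / 2.
  have : k <= e / 2 / (nrm (D * P0) + 1) by rewrite ge_min lexx orbT.
  by rewrite ler_pdivlMr //; nra.
clearbody k.
have [d2 d20 H2] := polar_expansion k0.
pose d3 := d1 / 6 / nrm P0.
have d30 : 0 < d3 by rewrite !divr_gt0.
exists (Num.min d2 d3); first by rewrite lt_min d20 d30.
move=> x t; rewrite !lt_min => /andP[xa xb] /andP[ta tb].
have := H2 _ _ xa ta; set u := x - x0; set v := t - t0 => H.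
set E := polar u v - 1 - (u +i* v) in H.
have uv0 : 0 <= `|u| + `|v| by rewrite addr_ge0.
have PE : polar x t - P0 = P0 * ((u +i* v) + E).
  rewrite (_ : (u +i* v) + E = polar u v - 1); last by rewrite /E; ring.
  rewrite mulrBr mulr1 -polarD.
  by congr (polar _ _ - _); rewrite /u /v; ring.
have nP : nrm (polar x t - P0) <= nrm P0 * (3 * (`|u| + `|v|)).
  rewrite PE nrmM ler_wpM2l ?nrm_ge0 // (le_trans (nrmD _ _)) //.
  have uv1 : nrm (u +i* v) <= `|u| + `|v| by exact: nrm_le_ReIm.
  have uv2 : k * (`|u| + `|v|) <= `|u| + `|v| by rewrite ler_piMl.
  clearbody u v E; lra.
have cc : c + polar x t - (c + P0) = polar x t - P0 by rewrite opprD addrACA subrr add0r.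
have /H1 : nrm (c + polar x t - (c + P0)) < d1.
  rewrite cc (le_lt_trans nP) //.
  have -> : d1 = nrm P0 * (6 * d3) by rewrite /d3; field; rewrite gt_eqF.
  by rewrite ltr_pM2l //; lra.
rewrite cc => H3.
have -> : h (c + polar x t) - h (c + P0) - D * P0 * (u +i* v) =
    (h (c + polar x t) - h (c + P0) - D * (polar x t - P0)) + D * P0 * E.
  by rewrite PE; ring.
apply: le_trans (nrmD _ _) _; rewrite [nrm (D * P0 * E)]nrmM.
have e1 : nrm (D * P0) * nrm E <= e / 2 * (`|u| + `|v|).
  apply: le_trans (_ : nrm (D * P0) * (k * (`|u| + `|v|)) <= _).
    by rewrite ler_wpM2l // nrm_ge0.
  by rewrite mulrA ler_wpM2r.
have e2 : e / 6 / nrm P0 * nrm (polar x t - P0) <= e / 2 * (`|u| + `|v|).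
  have -> : e / 2 * (`|u| + `|v|) = e / 6 / nrm P0 * (nrm P0 * (3 * (`|u| + `|v|))).
    by field; rewrite gt_eqF.
  by rewrite ler_wpM2l // ltW.
lra.
Qed.

Lemma cts_polar (x : R -> R) (t : R -> R) (s : R) :
  {for s, continuous x} -> {for s, continuous t} ->
  {for s, continuous (fun y => polar (x y) (t y) : R[i]^o)}.
Proof.
move=> cx ct; have ex : {for s, continuous (fun y => expR (x y))}.
  exact: (cvg_comp _ _ cx (@continuous_expR R _)).
apply: cts_pair; apply: cvgM => //.
  exact: (cvg_comp _ _ ct (@continuous_cos R _)).
exact: (cvg_comp _ _ ct (@continuous_sin R _)).
Qed.

End CircleMean.

(** * Circle means and the absence of strict interior maxima *)

Section NoStrictMax.
Variable R : realType.

(** A single choice for all functions gives equal functions the same primitive; this is what makes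
    the sides at angles 0 and [2 * pi] cancel. *)
Lemma primitive_operator (a : R) : exists P : (R -> R) -> (R -> R),
  forall f, continuous f -> forall x, a < x -> is_derive x 1 (P f) (f x).
Proof.
have H (f : R -> R) : exists A : R -> R, continuous f -> forall x, a < x -> is_derive x 1 A (f x).
  have [fc|nf] := pselect (continuous f); last by exists f.
  by have [A HA] := exists_primitive a fc; exists A.
by have [P HP] := choice H; exists P.
Qed.

Lemma polar_2pi (x : R) : polar x (2 * pi) = polar x 0.
Proof. by rewrite /polar mulr_natl cos2pi sin2pi cos0 sin0. Qed.

Lemma cts_minl (X : R) : continuous (fun x : R => Num.min x X).
Proof. by move=> x; apply: continuous_min; [exact: cvg_id|exact: cvg_cst]. Qed.

(* The mean of Re h over the circle |z - c| = s does not depend on s, since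
   Im (h dz / (z - c)) is closed, and it tends to Re (h c) as s tends to 0. *)
Lemma circle_mean (h : R[i]^o -> R[i]^o) (c : R[i]) (rho r d : R) :
  (forall z, nrm (z - c) < rho -> z != c -> derivable h z 1) ->
  {for (c : R[i]^o), continuous h} ->
  0 < r -> r < rho -> 0 < d ->
  (forall z, nrm (z - c) = r -> complex.Re (h z) <= complex.Re (h c) - d) ->
  False.
Proof.
move=> dh ch r0 rrho d0 hr.
have rho0 : 0 < rho by exact: lt_trans rrho.
have dhP x t : expR x < rho -> derivable h (c + polar x t) 1.
  move=> xr; apply: dh; first by rewrite addrC addKr nrm_polar.
  by rewrite -subr_eq0 addrC addKr -nrm_eq0 nrm_polar gt_eqF // expR_gt0.
have [s [s0 sr hs]] : exists s, [/\ 0 < s, s < r &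
    forall z, nrm (z - c) = s -> nrm (h z - h c) < d / 2].
  have d2 : 0 < d / 2 by rewrite divr_gt0.
  have /cts_epsP/(_ _ d2)[s0 s00 Hs] := ch.
  exists (Num.min s0 r / 2); split.
  - by rewrite divr_gt0 // lt_min s00.
  - have : Num.min s0 r <= r by rewrite ge_min lexx orbT.
    lra.
  - move=> z zs; apply: Hs; rewrite zs.
    have : Num.min s0 r <= s0 by rewrite ge_min lexx.
    have : 0 < Num.min s0 r by rewrite lt_min s00.
    lra.
(* [X] lies strictly beyond [x1], so near every point of the rectangle the truncation in [F] below
   is inactive and the Cauchy-Riemann equations hold two-sidedly. *)
pose X := ln ((r + rho) / 2); pose x0 := ln s; pose x1 := ln r.
have eX : expR X = (r + rho) / 2 by rewrite lnK // posrE; lra.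
have e0 : expR x0 = s by rewrite lnK // posrE.
have e1 : expR x1 = r by rewrite lnK // posrE.
have x01 : x0 < x1 by rewrite ltr_ln // posrE.
have x1X : x1 < X by rewrite -ltr_expR e1 eX; lra.
clearbody X x0 x1.
have minX x : expR (Num.min x X) < rho.
  have : expR (Num.min x X) <= expR X by rewrite ler_expR ge_min lexx orbT.
  by rewrite eX; lra.
(* Freezing the radius at [exp X < rho] gives a function continuous on the whole line, as the
   primitives require. *)
pose F x t := h (c + polar (Num.min x X) t).
pose U x t := complex.Re (F x t); pose V x t := complex.Im (F x t).
have FE x t : x <= X -> F x t = h (c + polar x t) by move=> xX; rewrite /F min_l.
have cF (x t : R -> R) y : {for y, continuous x} -> {for y, continuous t} ->
    {for y, continuous (fun y => F (x y) (t y))}.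
  move=> cx ct; rewrite /F.
  have c1 := cvg_comp _ _ cx (@cts_minl X (x y)).
  have c2 : {for y, continuous (fun y => c + polar (Num.min (x y) X) (t y) : R[i]^o)}.
    apply: cvgD; first exact: cvg_cst.
    exact: (@cts_polar _ (fun y => Num.min (x y) X) t y c1 ct).
  exact: (cvg_comp _ _ c2 (derivable_cts (dhP _ _ (minX _)))).
have cV t : continuous (fun x => V x t).
  move=> x; have c1 : {for x, continuous (fun y => F y t)}.
    by apply: cF; [exact: cvg_id|exact: cvg_cst].
  exact: (cvg_comp _ _ c1 (@cts_Im R _)).
have cU x : continuous (fun t => U x t).
  move=> t; have c1 : {for t, continuous (fun y => F x y)}.
    by apply: cF; [exact: cvg_cst|exact: cvg_id].
  exact: (cvg_comp _ _ c1 (@cts_Re R _)).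
(* One base point to the left of both ranges: [x] starts at [x0] and the angle at 0. *)
have [P HP] := primitive_operator (Num.min x0 0 - 1).
have m0 : Num.min x0 0 <= x0 by rewrite ge_min lexx.
have m1 : Num.min x0 0 <= 0 by rewrite ge_min lexx orbT.
pose A t := P (fun x => V x t); pose B x := P (fun t => U x t).
have pi20 : 0 < 2 * pi :> R by rewrite mulr_gt0 // pi_gt0.
have sx : 0 < x1 - x0 by rewrite subr_gt0.
have Vper : (fun x => V x (2 * pi)) = (fun x => V x 0).
  by apply/funext => x; rewrite /V /F polar_2pi.
have dA t x : x0 <= x <= x0 + (x1 - x0) -> is_derive x 1 (A t) (V x t).
  by move=> xx; apply: HP; [exact: cV|lra].
have dB x t : x0 <= x <= x0 + (x1 - x0) -> 0 <= t <= 0 + 2 * pi ->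
    is_derive t 1 (B x) (U x t).
  by move=> _ tt; apply: HP; [exact: cU|lra].
have dUV y0 t0 : x0 <= y0 <= x0 + (x1 - x0) -> exists p q : R,
  forall e, 0 < e -> exists2 d : R, 0 < d &
    forall x t, `|x - y0| < d -> `|t - t0| < d ->
      `|U x t - (U y0 t0 + p * (x - y0) - q * (t - t0))|
        <= e * (`|x - y0| + `|t - t0|) /\
      `|V x t - (V y0 t0 + q * (x - y0) + p * (t - t0))|
        <= e * (`|x - y0| + `|t - t0|).
  move=> y01; have y0X : y0 < X by lra.
  have yr : expR y0 < rho by have := minX y0; rewrite min_l // ltW.
  have [p [q H]] := polar_cauchy_riemann (dhP y0 t0 yr).
  exists p, q => e e00; have [d1 d10 Hd] := H e e00.
  exists (Num.min d1 (X - y0)); first by rewrite lt_min d10 subr_gt0.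
  move=> x t; rewrite !lt_min => /andP[xd xX] /andP[td _].
  have {}xX : x <= X by move: xX; rewrite ltr_norml; lra.
  have := Hd x t xd td; rewrite -!FE // ?(ltW y0X) //; set Z := (X in nrm X).
  have -> : U x t - (U y0 t0 + p * (x - y0) - q * (t - t0)) = complex.Re Z.
    by rewrite /Z !ReD !ReN ReM /= /U; ring.
  have -> : V x t - (V y0 t0 + q * (x - y0) + p * (t - t0)) = complex.Im Z.
    by rewrite /Z !ImD !ImN ImM /= /V; ring.
  move=> Ze; split.
    exact: le_trans (abs_Re_le _) Ze.
  exact: le_trans (abs_Im_le _) Ze.
(* By periodicity the two sides of constant angle drop out, leaving equal increments of [B x0] and
   [B x1] over a full turn. *)
have := rectangle_integral_eq0 sx pi20 dA dB dUV.
rewrite add0r /A Vper addrC subrKC => mean.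
pose G t := B x1 t - B x0 t.
have dG t : 0 <= t <= 2 * pi -> is_derive t 1 G (U x1 t - U x0 t).
  move=> t2.
  have xx1 : x0 <= x1 <= x0 + (x1 - x0) by lra.
  have xx0 : x0 <= x0 <= x0 + (x1 - x0) by lra.
  have tt : 0 <= t <= 0 + 2 * pi by lra.
  exact: (is_deriveB (dB x1 t xx1 tt) (dB x0 t xx0 tt)).
have GU t : 0 <= t <= 2 * pi -> U x1 t - U x0 t <= - (d / 2).
  move=> _; rewrite /U !FE ?(ltW x1X) //; last lra.
  have := hr (c + polar x1 t); rewrite addrC addKr nrm_polar => /(_ e1).
  have := hs (c + polar x0 t); rewrite addrC addKr nrm_polar => /(_ e0).
  rewrite nrmBC => h1 h2.
  have := le_lt_trans (Re_le _) h1; rewrite ReD ReN; lra.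
have := increment_le (ltW pi20) dG GU.
rewrite /G subr0; have : 0 < d / 2 * (2 * pi) by rewrite mulr_gt0 // divr_gt0.
move: mean; rewrite /A; lra.
Qed.

End NoStrictMax.

(** * Holomorphic functions on the disc and the maximum principle *)

Section DiscFunctions.
Variable R : realType.
Implicit Types (h g : R[i] -> R[i]) (z w a c : R[i]) (E : seq R[i]).

(* The finite exceptional set E makes room for quotients h / (z - a), which are
   only known to be continuous at a zero a of h. *)
Definition holo_off E h :=
  (forall z, nrm z < 1 -> {for (z : R[i]^o), continuous (h : R[i]^o -> R[i]^o)}) /\
  (forall z, nrm z < 1 -> z \notin E ->
    derivable (h : R[i]^o -> R[i]^o) z 1).

Lemma holo_off_cst E (k : R[i]) : holo_off E (fun=> k).
Proof.
split=> z _.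
  by apply/cts_epsP => e e0; exists 1 => // w _; rewrite subrr nrm0.
by move=> _; exact: derivable_cst.
Qed.

Lemma holo_off_id E : holo_off E (fun z => z).
Proof.
split=> z _; first by apply/cts_epsP => e e0; exists e.
by move=> _; exact: derivable_id.
Qed.

Lemma holo_offD E h g : holo_off E h -> holo_off E g ->
  holo_off E (fun z => h z + g z).
Proof.
move=> [hc hd] [gc gd]; split=> z z1; last first.
  by move=> zE; exact: (derivableD (hd z z1 zE) (gd z z1 zE)).
exact: (cvgD (hc z z1) (gc z z1)).
Qed.

Lemma holo_offM E h g : holo_off E h -> holo_off E g ->
  holo_off E (fun z => h z * g z).
Proof.
move=> [hc hd] [gc gd]; split=> z z1; last first.
  by move=> zE; exact: (derivableM (hd z z1 zE) (gd z z1 zE)).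
exact: (cvgM (hc z z1) (gc z z1)).
Qed.

Lemma holo_offV E h : holo_off E h -> (forall z, nrm z < 1 -> h z != 0) ->
  holo_off E (fun z => (h z)^-1).
Proof.
move=> [hc hd] h0; split=> z z1; last first.
  by move=> zE; exact: (derivableV (h0 z z1) (hd z z1 zE)).
exact: (cvgV (h0 z z1) (hc z z1)).
Qed.

Lemma holo_offN E h : holo_off E h -> holo_off E (fun z => - h z).
Proof.
move=> [hc hd]; split=> z z1; last first.
  by move=> zE; exact: (derivableN (hd z z1 zE)).
exact: (cvgN (hc z z1)).
Qed.

Lemma holo_offB E h g : holo_off E h -> holo_off E g ->
  holo_off E (fun z => h z - g z).
Proof. by move=> Hh Hg; exact: (holo_offD Hh (holo_offN Hg)). Qed.

Lemma holo_off_div E h g : holo_off E h -> holo_off E g ->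
  (forall z, nrm z < 1 -> g z != 0) -> holo_off E (fun z => h z / g z).
Proof. by move=> Hh Hg g0; exact: (holo_offM Hh (holo_offV Hg g0)). Qed.

Lemma holo_off_sum E (I : eqType) (s : seq I) (P : pred I)
    (F : I -> R[i] -> R[i]) : (forall i, i \in s -> holo_off E (F i)) ->
  holo_off E (fun z => \sum_(i <- s | P i) F i z).
Proof.
elim: s => [|i s IH] HF.
  rewrite (_ : (fun z => _) = fun=> 0); first exact: holo_off_cst.
  by apply/funext => z; rewrite big_nil.
have {}IH : holo_off E (fun z => \sum_(j <- s | P j) F j z).
  by apply: IH => j js; apply: HF; rewrite inE js orbT.
have Pi : (fun z => \sum_(j <- i :: s | P j) F j z) = (fun z =>
    if P i then F i z + \sum_(j <- s | P j) F j z else \sum_(j <- s | P j) F j z).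
  by apply/funext => z; rewrite big_cons.
rewrite Pi; case: (P i); last exact: IH.
exact: (holo_offD (HF i (mem_head i s)) IH).
Qed.

Lemma punctured_disc_avoiding E c : exists2 s : R, 0 < s &
  forall z, nrm (z - c) < s -> z != c -> z \notin E.
Proof.
elim: E => [|a E [s s0 IH]]; first by exists 1.
have [->|ac] := eqVneq a c.
  by exists s => // z zs zc; rewrite inE negb_or zc IH.
exists (Num.min s (nrm (a - c))).
  by rewrite lt_min s0 nrm_gt0 subr_eq0.
move=> z; rewrite lt_min => /andP[zs za] zc.
rewrite inE negb_or IH // andbT; apply: contraTneq za => ->.
by rewrite ltxx.
Qed.

(** After a rotation by the unimodular [g], a value above [M] at [z0] is a large real part. Adding a
    small multiple of [|z| ^ 2] keeps the maximum inside and makes it strict up to a holomorphic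
    linear term, contradicting [circle_mean]. *)
Lemma max_principle E h (rho M : R) : holo_off E h -> 0 < rho -> rho < 1 ->
  (forall z, nrm z = rho -> nrm (h z) <= M) ->
  forall z, nrm z <= rho -> nrm (h z) <= M.
Proof.
move=> Hh rho0 rho1 hM z0 z0r; rewrite leNgt; apply/negP => Mh.
have M0 : 0 <= M.
  by apply: le_trans (hM rho%:C _); [exact: nrm_ge0|rewrite nrm_real_ge0 // ltW].
have n0 : 0 < nrm (h z0) by exact: le_lt_trans Mh.
pose g : R[i] := (h z0)^* / (nrm (h z0))%:C.
have nC : (nrm (h z0))%:C != 0 :> R[i] by rewrite eq_complex /= gt_eqF.
have g1 : nrm g = 1.
  by rewrite /g nrmM nrmV nrmJ nrm_real_ge0 ?nrm_ge0 // divff // gt_eqF.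
have gh0 : complex.Re (g * h z0) = nrm (h z0).
  rewrite /g mulrAC [_^* * _]mulrC mulJ (_ : _ / _ = (nrm (h z0))%:C) //.
  by rewrite -fmorphV -rmorphM /= expr2 mulfK // gt_eqF.
clearbody g.
(* On the circle of radius [rho] the function [u] stays below [M + e], hence below [u z0]. *)
pose e := (nrm (h z0) - M) / 2.
have e0 : 0 < e by rewrite divr_gt0 // subr_gt0.
pose u (z : R[i]^o) : R := complex.Re (g * h z) + e * (nrm z * nrm z).
have cu : {within [set z : R[i]^o | nrm z <= rho], continuous u}.
  apply: continuous_in_subspaceT => z; rewrite inE /= => zr.
  have z1 : nrm z < 1 by exact: le_lt_trans rho1.
  have c1 : {for z, continuous (fun z : R[i]^o => complex.Re (g * h z) : R)}.
    exact: (cvg_comp _ _ ((holo_offM (holo_off_cst E g) Hh).1 z z1) (@cts_Re R _)).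
  have c2 : {for z, continuous (fun z : R[i]^o => e * (nrm z * nrm z) : R)}.
    exact: (cvgM (cvg_cst e) (cvgM (@cts_nrm R z) (@cts_nrm R z))).
  exact: (cvgD c1 c2).
have [c cA cmax] := compact_EVT_max (ex_intro _ (z0 : R[i]^o) z0r)
  (@compact_disc R rho) cu.
rewrite inE /= in cA.
have umax z : nrm z <= rho -> u z <= u c by move=> zr; apply: cmax; rewrite inE.
have crho : nrm c < rho.
  rewrite lt_neqAle cA andbT; apply/eqP => cr.
  have := umax _ z0r; rewrite /u gh0 -!expr2.
  have := Re_le (g * h c); rewrite nrmM g1 mul1r; have := hM _ cr.
  have : 0 <= e * nrm z0 ^+ 2 by rewrite mulr_ge0 ?sqr_ge0 // ltW.
  have : e * nrm c ^+ 2 < e by rewrite gtr_pMr // expr_lt1 ?nrm_ge0 // cr.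
  by rewrite /e; lra.
have [s s0 sE] := punctured_disc_avoiding E c.
pose q := Num.min s (rho - nrm c).
have q0 : 0 < q by rewrite lt_min s0 subr_gt0.
have qs : q <= s by rewrite ge_min lexx.
have qr : q <= rho - nrm c by rewrite ge_min lexx orbT.
clearbody q.
(* In [|z| ^ 2 = |c| ^ 2 + 2 Re (c^* (z - c)) + |z - c| ^ 2] the middle term is the real part of a
   holomorphic function and is absorbed in [k]; the last one becomes the gap [e * (q / 2) ^+ 2]. *)
pose k z : R[i] := g * h z + (2 * e)%:C * c^* * (z - c).
have zrho z : nrm (z - c) < q -> nrm z < rho.
  by move=> zc; have := nrm_tri2 z c; lra.
have Hk : holo_off E k := holo_offD (holo_offM (holo_off_cst E g) Hh)
  (holo_offM (holo_off_cst E ((2 * e)%:C * c^*))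
    (holo_offB (holo_off_id E) (holo_off_cst E c))).
have kd z : nrm (z - c) < q -> z != c -> derivable (k : R[i]^o -> R[i]^o) z 1.
  move=> zq zc; apply: Hk.2; first exact: lt_trans (zrho _ zq) rho1.
  by apply: sE zc; exact: lt_le_trans qs.
have kc := Hk.1 c (lt_trans crho rho1).
apply: (circle_mean kd kc (r := q / 2) (d := e * (q / 2) ^+ 2)).
- by rewrite divr_gt0.
- lra.
- by rewrite mulr_gt0 // exprn_gt0 // divr_gt0.
- move=> z zc; have zr : nrm z <= rho by rewrite ltW // zrho // zc; lra.
  have := umax z zr; rewrite /u /k subrr mulr0 addr0 -zc -!expr2 !nrm_sq !(ReD, ReM) conjE.
  by case: z {zc zr} => x y; case: c {cA cmax umax crho sE qr zrho kd kc Hk k} => x0 y0 /=; lra.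
Qed.

Lemma disc_automorphism_identity z w :
  nrm (1 - w^* * z) ^+ 2 - nrm (z - w) ^+ 2 = (1 - nrm z ^+ 2) * (1 - nrm w ^+ 2).
Proof.
by rewrite !conjE !nrm_sq; case: z => a b; case: w => c d /=; ring.
Qed.

Lemma subr1_neq0 z : nrm z < 1 -> 1 - z != 0.
Proof.
move=> z1; rewrite subr_eq0; apply: contraTneq z1 => <-.
by rewrite nrm1 ltxx.
Qed.

Lemma nrm_1subM z w : nrm z < 1 -> nrm w <= 1 -> 1 - z^* * w != 0.
Proof.
move=> z1 w1; apply: subr1_neq0.
by rewrite nrmM nrmJ mulrC (le_lt_trans _ z1) // ler_piMl // nrm_ge0.
Qed.

Lemma nrm_sub_le z w : nrm z <= 1 -> nrm w <= 1 ->
  nrm (z - w) <= nrm (1 - w^* * z).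
Proof.
move=> z1 w1; apply: nrm_le_abs; first exact: nrm_ge0.
rewrite -subr_ge0 disc_automorphism_identity mulr_ge0 // subr_ge0 expr_le1 //;
  exact: nrm_ge0.
Qed.

Definition mobius a z : R[i] := (z - a) / (1 - a^* * z).

Lemma mobius_le1 a z : nrm a < 1 -> nrm z <= 1 -> nrm (mobius a z) <= 1.
Proof.
move=> a1 z1; rewrite /mobius nrmM nrmV ler_pdivrMr ?mul1r.
  by apply: nrm_sub_le => //; exact: ltW.
by rewrite nrm_gt0 nrm_1subM.
Qed.

Lemma mobius_lt1 a z : nrm a < 1 -> nrm z < 1 -> nrm (mobius a z) < 1.
Proof.
move=> a1 z1; have d0 : 0 < nrm (1 - a^* * z) by rewrite nrm_gt0 nrm_1subM // ltW.
rewrite /mobius nrmM nrmV ltr_pdivrMr // mul1r.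
rewrite -(ltr_pXn2r (n := 2)) ?nnegrE ?nrm_ge0 // -subr_gt0 disc_automorphism_identity.
by rewrite mulr_gt0 // subr_gt0 expr_lt1 // nrm_ge0.
Qed.

End DiscFunctions.

(** * Dividing out zeros; the Schwarz lemma for several nodes *)

Section Division.
Variable R : realType.
Implicit Types (h g : R[i] -> R[i]) (z w a c : R[i]) (E : seq R[i]).

Lemma cts_locally_eq h g z (s : R) : 0 < s ->
  (forall w, nrm (w - z) < s -> h w = g w) ->
  {for (z : R[i]^o), continuous (g : R[i]^o -> R[i]^o)} ->
  {for (z : R[i]^o), continuous (h : R[i]^o -> R[i]^o)}.
Proof.
move=> s0 hg /cts_epsP gc; apply/cts_epsP => e e0; have [d d0 H] := gc e e0.
exists (Num.min s d); first by rewrite lt_min s0.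
move=> w; rewrite lt_min => /andP[ws wd]; rewrite !hg ?subrr ?nrm0 //.
exact: H.
Qed.

Lemma derivable_locally_eq h g z (s : R) : 0 < s ->
  (forall w, nrm (w - z) < s -> h w = g w) ->
  derivable (g : R[i]^o -> R[i]^o) z 1 -> derivable (h : R[i]^o -> R[i]^o) z 1.
Proof.
move=> s0 hg; apply: near_eq_derivable.
by apply/nbhs_nrmP; exists s => // w /hg.
Qed.

Lemma cts_divX h a : derivable (h : R[i]^o -> R[i]^o) a 1 -> h a = 0 ->
  exists D : R[i], {for (a : R[i]^o), continuous
    ((fun w => if w == a then D else h w / (w - a)) : R[i]^o -> R[i]^o)}.
Proof.
move=> /derivable_epsP[D HD] ha; exists D; apply/cts_epsP => e e0.
have e2 : 0 < e / 2 by rewrite divr_gt0.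
have [d d0 H] := HD _ e2; exists d => // w wd; rewrite eqxx.
case: eqVneq => [_|wa]; first by rewrite subrr nrm0.
have wa0 : w - a != 0 by rewrite subr_eq0.
have n0 : 0 < nrm (w - a) by rewrite nrm_gt0.
have := H w wd; rewrite ha subr0 => Hw.
have -> : h w / (w - a) - D = (h w - D * (w - a)) / (w - a) by field.
rewrite nrmM nrmV ltr_pdivrMr // (le_lt_trans Hw) // ltr_pM2r //; lra.
Qed.

Lemma le_of_scaled_le (x M : R) : 0 <= M ->
  (forall m, 0 < m -> m < 1 -> m * x <= M) -> x <= M.
Proof.
move=> M0 H; rewrite leNgt; apply/negP => Mx.
have x0 : 0 < x by exact: le_lt_trans Mx.
have m1 : (M + x) / (2 * x) < 1 by rewrite ltr_pdivrMr ?mulr_gt0 //; lra.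
have m0 : 0 < (M + x) / (2 * x) by rewrite divr_gt0 ?mulr_gt0 //; lra.
have := H _ m0 m1.
have -> : (M + x) / (2 * x) * x = (M + x) / 2 by field; rewrite gt_eqF.
lra.
Qed.

(* |1 - a^* w| ^ 2 - |w - a| ^ 2 = (1 - |w| ^ 2) (1 - |a| ^ 2) while
   |1 - a^* w| >= 1 - |a|, so the Moebius factor tends to 1 at the circle. *)
Lemma mobius_near_circle a (m : R) : nrm a < 1 -> 0 < m -> m < 1 ->
  exists2 t : R, 0 < t & forall w, 1 - t < nrm w -> nrm w <= 1 ->
    m <= nrm (mobius a w).
Proof.
move=> a1 m0 m1; have a0 := nrm_ge0 a.
(* Since [1 - |w| ^ 2 <= 2 t], the identity quoted above yields
   [1 - |mobius a w| ^ 2 <= 1 - m ^ 2]. *)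
pose t := (1 - m ^+ 2) * (1 - nrm a) ^+ 2 / 2.
have s0 : 0 < 1 - nrm a by rewrite subr_gt0.
have m2 : 0 < 1 - m ^+ 2 by rewrite subr_gt0 expr_lt1 // ltW.
have t0 : 0 < t by rewrite divr_gt0 // mulr_gt0 // exprn_gt0.
have et : 2 * t = (1 - m ^+ 2) * (1 - nrm a) ^+ 2 by rewrite /t; field.
clearbody t; exists t => // w wt w1.
have d0 : 0 < nrm (1 - a^* * w) by rewrite nrm_gt0 nrm_1subM.
rewrite /mobius nrmM nrmV ler_pdivlMr //.
rewrite -(ler_pXn2r (n := 2)) ?nnegrE ?mulr_ge0 ?nrm_ge0 ?(ltW m0) //.
have := disc_automorphism_identity w a.
have da : 1 - nrm a <= nrm (1 - a^* * w).
  rewrite (le_trans _ (nrm_tri2 _ _)) // nrm1 lerD2l lerN2 nrmM nrmJ.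
  by rewrite ler_piMr.
have da2 : (1 - nrm a) ^+ 2 <= nrm (1 - a^* * w) ^+ 2.
  by rewrite ler_pXn2r // nnegrE ltW.
have w0 := nrm_ge0 w.
have ww : 1 - nrm w ^+ 2 <= 2 * t.
  have [t1|t1] := leP t 1; last by have := sqr_ge0 (nrm w); lra.
  have : (1 - t) ^+ 2 <= nrm w ^+ 2 by rewrite ler_pXn2r // ?nnegrE ?subr_ge0 // ltW.
  rewrite sqrrB expr1n mul1r; have := sqr_ge0 t; lra.
have ww0 : 0 <= 1 - nrm w ^+ 2 by rewrite subr_ge0 expr_le1.
have aa : (1 - nrm w ^+ 2) * (1 - nrm a ^+ 2) <= 1 - nrm w ^+ 2.
  by rewrite ler_piMr // lerBlDr lerDl sqr_ge0.
have mm : (1 - m ^+ 2) * (1 - nrm a) ^+ 2 <= (1 - m ^+ 2) * nrm (1 - a^* * w) ^+ 2.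
  by rewrite ler_wpM2l // ltW.
rewrite exprMn; lra.
Qed.

(** The bound survives division because on circles close enough to the unit circle the Moebius
    factor is at least [m]: there the quotient is at most [M / m], the maximum principle carries
    this to [z], and [m] tends to 1. The point [a] becomes exceptional for the quotient. *)
Lemma division E h a (M : R) : holo_off E h -> nrm a < 1 -> a \notin E ->
  h a = 0 -> (forall z, nrm z < 1 -> nrm (h z) <= M) ->
  exists h1, [/\ holo_off (a :: E) h1,
    (forall z, nrm z < 1 -> h z = mobius a z * h1 z) &
    (forall z, nrm z < 1 -> nrm (h1 z) <= M)].
Proof.
move=> Hh a1 aE ha hM; have [D HD] := cts_divX (Hh.2 a a1 aE) ha.
pose k w := if w == a then D else h w / (w - a).
have hk z : h z = (z - a) * k z.
  rewrite /k; case: eqVneq => [->|za]; first by rewrite ha subrr mul0r.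
  by rewrite mulrCA divff ?mulr1 // subr_eq0.
have kloc z : z != a -> exists2 s : R, 0 < s &
    forall w, nrm (w - z) < s -> k w = h w / (w - a).
  move=> za; exists (nrm (a - z)); first by rewrite nrm_gt0 subr_eq0 eq_sym.
  move=> w wz; rewrite /k; case: eqVneq => // wa.
  by move: wz; rewrite wa ltxx.
have Hk : holo_off (a :: E) k.
  split=> z z1.
    have [->|za] := eqVneq z a; first exact: HD.
    have [s s0 Hs] := kloc z za; apply: (cts_locally_eq s0 Hs).
    have c1 : {for (z : R[i]^o), continuous ((fun w => w - a) : R[i]^o -> R[i]^o)}.
      exact: ((holo_offB (holo_off_id E) (holo_off_cst E a)).1 z z1).
    have za0 : (z - a : R[i]) != 0 by rewrite subr_eq0.
    exact: (cvgM (Hh.1 z z1) (cvgV za0 c1)).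
  rewrite inE negb_or => /andP[za zE].
  have [s s0 Hs] := kloc z za; apply: (derivable_locally_eq s0 Hs).
  have d1 : derivable ((fun w => w - a) : R[i]^o -> R[i]^o) z 1.
    exact: ((holo_offB (holo_off_id E) (holo_off_cst E a)).2 z z1 zE).
  have za0 : (z - a : R[i]) != 0 by rewrite subr_eq0.
  exact: (derivableM (Hh.2 z z1 zE) (derivableV za0 d1)).
clearbody k.
pose h1 z := (1 - a^* * z) * k z.
have H1 : holo_off (a :: E) h1 := holo_offM (holo_offB (holo_off_cst _ 1)
  (holo_offM (holo_off_cst _ a^*) (holo_off_id _))) Hk.
have h1E z : nrm z < 1 -> h z = mobius a z * h1 z.
  by move=> z1; rewrite hk /h1 /mobius mulrA divfK // nrm_1subM // ltW.
exists h1; split => // z z1.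
have M0 : 0 <= M by apply: le_trans (hM 0 _); rewrite ?nrm_ge0 // nrm0.
apply: le_of_scaled_le => // m m0 m1.
have [t t0 Ht] := mobius_near_circle a1 m0 m1.
pose rho := Num.max (1 - t / 2) ((1 + nrm z) / 2).
have z0 := nrm_ge0 z.
have rz : (1 + nrm z) / 2 <= rho by rewrite le_max lexx orbT.
have rt : 1 - t / 2 <= rho by rewrite le_max lexx.
have r1 : rho < 1 by rewrite gt_max; apply/andP; split; lra.
have r0 : 0 < rho by lra.
clearbody rho; rewrite mulrC -ler_pdivlMr //.
apply: (max_principle H1 r0 r1); last by lra.
move=> w wr; rewrite ler_pdivlMr //.
have w1 : nrm w < 1 by rewrite wr.
apply: le_trans (hM w w1); rewrite (h1E w w1) nrmM mulrC ler_wpM2r ?nrm_ge0 //.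
by apply: Ht; lra.
Qed.

(** Each division keeps the bound [M] and adds one exceptional point; [uniq] keeps the remaining
    zeros away from it and makes them zeros of the quotient. *)
Lemma zeros_bound E h (as_ : seq R[i]) (M : R) : holo_off E h ->
  (forall z, nrm z < 1 -> nrm (h z) <= M) -> uniq as_ ->
  (forall a, a \in as_ -> [/\ nrm a < 1, a \notin E & h a = 0]) ->
  forall z, nrm z < 1 -> nrm (h z) <= M * \prod_(a <- as_) nrm (mobius a z).
Proof.
elim: as_ E h => [|a s IH] E h Hh hM us hs z z1.
  by rewrite big_nil mulr1 hM.
have [a1 aE ha] := hs a (mem_head a s).
have [h1 [H1 h1E h1M]] := division Hh a1 aE ha hM.
rewrite big_cons h1E // nrmM mulrCA ler_wpM2l ?nrm_ge0 //.
move: us => /= /andP[nas us].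
apply: (IH (a :: E)) => // b bs.
have [b1 bE hb] : [/\ nrm b < 1, b \notin E & h b = 0].
  by apply: hs; rewrite inE bs orbT.
have ba : b != a by apply: contraNneq nas => <-.
split => //; first by rewrite inE negb_or ba.
apply/eqP; have /eqP := hb; rewrite h1E // !mulf_eq0 invr_eq0 subr_eq0.
by rewrite (negbTE ba) (negbTE (nrm_1subM a1 (ltW b1))).
Qed.

Lemma conj_scale (s : R) c : (s%:C * c)^* = s%:C * c^*.
Proof.
by rewrite !conjE; case: c => x y; apply/eqP; rewrite eq_complex /=; apply/andP; split;
  apply/eqP; ring.
Qed.

(* Schwarz-Pick for s g between a and z, and s -> 1. *)
Lemma modulus_max_constant E g a : holo_off E g ->
  (forall z, nrm z < 1 -> nrm (g z) <= 1) -> nrm a < 1 -> a \notin E ->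
  nrm (g a) = 1 -> forall z, nrm z < 1 -> g z = g a.
Proof.
move=> Hg g1 a1 aE ga z z1.
apply/eqP; rewrite -subr_eq0 -nrm_eq0; apply/eqP.
set c := g a in ga *.
have b1 := mobius_lt1 a1 z1; set b := nrm (mobius a z) in b1.
have b0 : 0 <= b by exact: nrm_ge0.
have key (s : R) : 0 < s -> s < 1 ->
    s * nrm (g z - c) <= b * nrm (1 - (s%:C * c)^* * (s%:C * g z)).
  move=> s0 s1; have ns : nrm (s%:C : R[i]) = s by rewrite nrm_real_ge0 // ltW.
  have cs1 : nrm (s%:C * c) < 1 by rewrite nrmM ns ga mulr1.
  have gs1 w : nrm w < 1 -> nrm (s%:C * g w) <= 1.
    by move=> w1; rewrite nrmM ns mulr_ile1 ?nrm_ge0 ?g1 // ltW.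
  (* At [s = 1] the centre would be unimodular and the Moebius map would degenerate to the constant
     [- c]; hence the scaling. *)
  pose G w := mobius (s%:C * c) (s%:C * g w).
  have Hsg := holo_offM (holo_off_cst E s%:C) Hg.
  have HG : holo_off E G.
    have d0 w : nrm w < 1 -> 1 - (s%:C * c)^* * (s%:C * g w) != 0.
      by move=> w1; rewrite nrm_1subM // gs1.
    exact: (holo_off_div (holo_offB Hsg (holo_off_cst E (s%:C * c)))
      (holo_offB (holo_off_cst E 1) (holo_offM (holo_off_cst E (s%:C * c)^*) Hsg)) d0).
  have GM w : nrm w < 1 -> nrm (G w) <= 1.
    by move=> w1; rewrite mobius_le1 // gs1.
  have Ga x : x \in [:: a] -> [/\ nrm x < 1, x \notin E & G x = 0].
    by rewrite inE => /eqP ->; split => //; rewrite /G /mobius subrr mul0r.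
  have := zeros_bound HG GM (isT : uniq [:: a]) Ga z1.
  rewrite big_seq1 mul1r /G {1}/mobius nrmM nrmV ler_pdivrMr.
    by rewrite -mulrBr nrmM ns.
  by rewrite nrm_gt0 nrm_1subM // gs1.
set x := nrm (g z - c) in key *.
have x0 : 0 <= x by exact: nrm_ge0.
apply/eqP; rewrite eq_le x0 andbT leNgt; apply/negP => xpos.
have key2 (s : R) : 0 < s -> s < 1 -> s * x <= b * (x + (1 - s ^+ 2)).
  move=> s0 s1; apply: le_trans (key s s0 s1) _; rewrite ler_wpM2l //.
  have -> : 1 - (s%:C * c)^* * (s%:C * g z) =
      c^* * (c - g z) + (1 - s ^+ 2)%:C * (c^* * g z).
    have cc : c^* * c = 1 by rewrite mulrC mulJ ga expr1n.
    have ss : (1 - s ^+ 2)%:C = 1 - s%:C * s%:C :> R[i].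
      by rewrite rmorphB rmorphXn rmorph1 expr2.
    by rewrite conj_scale ss mulrBr cc; ring.
  apply: le_trans (nrmD _ _) _; rewrite !nrmM !nrmJ ga !mul1r nrmBC.
  rewrite lerD2l nrm_real_ge0; last by rewrite subr_ge0 expr_le1 // ltW.
  by rewrite ler_piMr ?g1 // subr_ge0 expr_le1 // ltW.
(* Taking [s = 1 - t] in [key2] gives [(1 - b) * x <= t * (2 + x)], and this [t] makes the right
   side half of the left one. *)
pose t := (1 - b) * x / (2 * (2 + x)).
have t0 : 0 < t by rewrite divr_gt0 ?mulr_gt0 //; lra.
have et : t * (2 + x) = (1 - b) * x / 2 by rewrite /t; field; rewrite gt_eqF //; lra.
have t1 : t < 1.
  rewrite ltr_pdivrMr ?mul1r; last by lra.
  have : (1 - b) * x <= x by rewrite ler_piMl //; lra.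
  lra.
clearbody t.
have := key2 (1 - t); rewrite subr_gt0 t1 ltrBlDr ltrDl t0 => /(_ isT isT).
have -> : 1 - (1 - t) ^+ 2 = 2 * t - t ^+ 2 by ring.
have : b * (2 * t) <= 2 * t by rewrite ler_piMl //; lra.
have := mulr_ge0 b0 (sqr_ge0 t).
have := mulr_gt0 (_ : 0 < 1 - b) xpos; rewrite subr_gt0 => /(_ b1).
rewrite !mulrDl !mulrDr; lra.
Qed.

End Division.

(** * The Schur algorithm for Pick interpolation *)

Section Interpolation.
Variable R : realType.
Implicit Types (g : R[i] -> R[i]) (z w a c k : R[i]) (E : seq R[i]) (p q : {poly R[i]}).

Definition schur E g :=
  holo_off E g /\ forall z, nrm z < 1 -> nrm (g z) <= 1.

(* p / q is a unimodular constant or a finite Blaschke product of degree n. *)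
Definition inner_pair p q (n : nat) (k : R[i]) :=
  [/\ nrm k = 1,
      forall z, z != 0 -> q.[z] = k * z ^+ n * (p.[(z^*)^-1])^*,
      forall z, nrm z <= 1 -> nrm p.[z] <= nrm q.[z] &
      forall z, nrm z <= 1 -> q.[z] != 0].

Lemma conj_mulV k : nrm k = 1 -> k * k^* = 1.
Proof. by move=> k1; rewrite mulJ k1 expr1n. Qed.

Lemma inner_pair_cst c : nrm c = 1 -> inner_pair c%:P 1%:P 0 c.
Proof.
move=> c1; split => // z _; rewrite !hornerC ?expr0 ?mulr1 ?oner_eq0 //.
- by rewrite conj_mulV.
- by rewrite c1 nrm1.
Qed.

(** Homogeneous form of [disc_automorphism_identity], comparing numerator and denominator without
    dividing. *)
Lemma inner_step_identity c z w :
  nrm (z + c^* * w) ^+ 2 - nrm (c * z + w) ^+ 2 =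
  (1 - nrm c ^+ 2) * (nrm z ^+ 2 - nrm w ^+ 2).
Proof.
rewrite conjE !nrm_sq; case: z => z1 z2; case: w => w1 w2.
by case: c => x y /=; ring.
Qed.

(** Inverse Schur step: with [B = p / q] and [b = mobius a], the new quotient is
    [(c + b B) / (1 + c^* b B)], an inner function with value [c] at [a]. The extra linear factors
    raise the degree by one and leave [k] unchanged. *)
Lemma inner_pair_step p q n k a c : inner_pair p q n k -> nrm a < 1 -> nrm c < 1 ->
  inner_pair (c%:P * ((1 - a^* *: 'X) * q) + ('X - a%:P) * p)
             ((1 - a^* *: 'X) * q + (c^*)%:P * (('X - a%:P) * p)) n.+1 k.
Proof.
move=> [k1 qp pq q0] a1 c1.
set p' := (X in inner_pair X _ _ _); set q' := (X in inner_pair _ X _ _).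
have ep z : p'.[z] = c * ((1 - a^* * z) * q.[z]) + (z - a) * p.[z].
  by rewrite /p' !(hornerE, hornerZ) /=; ring.
have eq z : q'.[z] = (1 - a^* * z) * q.[z] + c^* * ((z - a) * p.[z]).
  by rewrite /q' !(hornerE, hornerZ) /=; ring.
split => // z.
- move=> z0; have zJ0 : z^* != 0 by rewrite conj_eq0.
  have zi0 : (z^*)^-1 != 0 by rewrite invr_eq0.
  have e2 : q.[(z^*)^-1] = k * (z^*)^-1 ^+ n * (p.[z])^*.
    by rewrite qp // conjV conjK invrK.
  rewrite eq ep e2.
  rewrite !(conjD, conjM, conjN, conj1, conjV, conjX, conjK).
  have e1 : (p.[(z^*)^-1])^* = k^* * z ^- n * q.[z].
    rewrite qp // -[LHS]mul1r -(conj_mulV k1); field.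
    by rewrite expf_neq0.
  rewrite e1.
  have kk := conj_mulV k1.
  have zn : z ^+ n != 0 by rewrite expf_neq0.
  have -> : k * z ^+ n.+1 * (c^* * ((1 - a * z^-1) * (k^* * z^-1 ^+ n * p.[z])) +
     (z^-1 - a^*) * (k^* * z ^- n * q.[z])) = (k * k^*) *
     (c^* * ((z - a) * p.[z]) + (1 - a^* * z) * q.[z]).
    by rewrite exprS exprVn; field; rewrite zn.
  by rewrite kk mul1r addrC.
- move=> z1; rewrite ?ep eq.
  set u := (1 - a^* * z) * q.[z]; set v := (z - a) * p.[z].
  have vu : nrm v <= nrm u.
    by rewrite !nrmM ler_pM ?nrm_ge0 ?pq // nrm_sub_le // ltW.
  apply: nrm_le_abs; first exact: nrm_ge0.
  rewrite -subr_ge0.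
  rewrite inner_step_identity.
  rewrite mulr_ge0 // subr_ge0; first by rewrite expr_le1 ?nrm_ge0 // ltW.
  by rewrite ler_pXn2r // nnegrE nrm_ge0.
- move=> z1; rewrite ?ep eq.
  set u := (1 - a^* * z) * q.[z]; set v := (z - a) * p.[z].
  have vu : nrm v <= nrm u.
    by rewrite !nrmM ler_pM ?nrm_ge0 ?pq // nrm_sub_le // ltW.
  have u0 : 0 < nrm u by rewrite nrm_gt0 mulf_neq0 ?q0 // nrm_1subM.
  rewrite addr_eq0; apply/negP => /eqP uv.
  have := congr1 (fun x => nrm x) uv; rewrite /= nrmN [nrm (c^* * _)]nrmM nrmJ => e.
  have : nrm c * nrm v < nrm u; last by rewrite -e ltxx.
  have [v0|v0] := eqVneq (nrm v) 0; first by rewrite v0 mulr0.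
  rewrite (lt_le_trans _ vu) // gtr_pMl // lt_def v0; exact: nrm_ge0.
Qed.

Lemma holo_off_horner E p : holo_off E (fun z => p.[z]).
Proof.
elim/poly_ind: p => [|p c IH].
  rewrite (_ : (fun z => _) = fun=> 0); first exact: holo_off_cst.
  by apply/funext => z; rewrite horner0.
rewrite (_ : (fun z => _) = fun z => p.[z] * z + c).
  exact: (holo_offD (holo_offM IH (holo_off_id E)) (holo_off_cst E c)).
by apply/funext => z; rewrite hornerMXaddC.
Qed.

(** If [g a] is unimodular, [g] is constant off [E]. Otherwise [mobius (g a) (g z)] vanishes at [a],
    dividing by [mobius a] gives a Schur function for the remaining nodes, and [inner_pair_step]
    undoes the reduction. The last clause excludes degree 0, since [blaschke] always has at least
    one factor. *)
Lemma schur_interpolation (s : seq R[i]) E g : schur E g -> uniq s ->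
  (forall a, a \in s -> nrm a < 1 /\ a \notin E) ->
  exists p q n k, [/\ inner_pair p q n k,
    forall a, a \in s -> g a * q.[a] = p.[a] &
    forall a, ohead s = Some a -> nrm (g a) < 1 -> (0 < n)%N].
Proof.
elim: s E g => [|a s IH] E g [Hg g1] us sE.
  by exists 1%:P, 1%:P, 0%N, 1; split => //; apply: inner_pair_cst; rewrite nrm1.
have [a1 aE] := sE a (mem_head _ _).
have [c1|c1] := leP 1 (nrm (g a)).
  have {}c1 : nrm (g a) = 1 by apply/eqP; rewrite eq_le c1 g1.
  exists (g a)%:P, 1%:P, 0%N, (g a); split.
  - exact: inner_pair_cst.
  - move=> b bs; rewrite !hornerC mulr1; apply: (modulus_max_constant Hg) => //.
    by have [] := sE b bs.
  - by move=> b [<-]; rewrite c1 ltxx.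
have d0 z : nrm z < 1 -> 1 - (g a)^* * g z != 0.
  by move=> z1; rewrite nrm_1subM // g1.
have HG : holo_off E (fun z => mobius (g a) (g z)).
  exact: (holo_off_div (holo_offB Hg (holo_off_cst E (g a)))
    (holo_offB (holo_off_cst E 1) (holo_offM (holo_off_cst E (g a)^*) Hg)) d0).
have GM z : nrm z < 1 -> nrm (mobius (g a) (g z)) <= 1.
  by move=> z1; rewrite mobius_le1 // g1.
have Ga : mobius (g a) (g a) = 0 by rewrite /mobius subrr mul0r.
have [h [Hh hE h1]] := division HG a1 aE Ga GM.
move: us => /= /andP[nas us].
have [|p [q [n [k [pq hpq _]]]]] := IH (a :: E) h (conj Hh h1) us.
  move=> b bs; have [b1 bE] : nrm b < 1 /\ b \notin E by apply: sE; rewrite inE bs orbT.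
  by split => //; rewrite inE negb_or bE andbT; apply: contraNneq nas => <-.
have := inner_pair_step pq a1 c1.
set p' := (X in inner_pair X _ _ _); set q' := (X in inner_pair _ X _ _) => pq'.
exists p', q', n.+1, k; split => // b; rewrite inE => /predU1P[->|bs].
  by rewrite /p' /q' !(hornerE, hornerZ) /=; ring.
have [b1 bE] : nrm b < 1 /\ b \notin E by apply: sE; rewrite inE bs orbT.
have := hE b b1; have := hpq b bs; rewrite {1}/mobius => hb.
have n0 : 1 - a^* * b != 0 by rewrite nrm_1subM // ltW.
have n1 := d0 b b1.
rewrite /mobius => /(congr1 (fun x => x * (1 - (g a)^* * g b) * (1 - a^* * b))).
rewrite divfK // [_ * _ * (1 - a^* * b)]mulrC !mulrA.
rewrite [(1 - a^* * b) * (b - a)]mulrC mulfK // => e.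
rewrite /p' /q' !(hornerE, hornerZ) /= -hb.
apply/eqP; rewrite -subr_eq0; apply/eqP.
transitivity (((g b - g a) * (1 - a^* * b) -
  (b - a) * h b * (1 - (g a)^* * g b)) * q.[b]); first by ring.
by rewrite e subrr mul0r.
Qed.

End Interpolation.

(** * Inner pairs as Blaschke products; Caratheodory approximation *)

Section Caratheodory.
Variable R : realType.
Implicit Types (g : R[i] -> R[i]) (z w a c k : R[i]) (E : seq R[i]) (p q : {poly R[i]}).

Lemma poly_eq_off0 p q : (forall z, z != 0 -> p.[z] = q.[z]) -> p = q.
Proof.
move=> pq; apply/eqP; rewrite -subr_eq0; apply/eqP.
apply: (@roots_geq_poly_eq0 _ _ [seq i.+1%:R | i <- iota 0 (size (p - q))]).
- apply/allP => _ /mapP[i _ ->].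
  by rewrite rootE hornerD hornerN pq ?subrr // pnatr_eq0.
- rewrite map_inj_uniq ?iota_uniq // => i j /eqP.
  by rewrite eqr_nat => /eqP [].
- by rewrite size_map size_iota.
Qed.

(** The linear factors of [p] reflect into those of [q]. Comparing orders of vanishing at 0, where
    [q] is nonzero, shows that [p] has exactly [n.+1] roots; a root outside the open disc would
    reflect to a zero of [q] in the closed disc. *)
Lemma inner_pair_blaschke p q n k : inner_pair p q n.+1 k ->
  exists2 B, finite_blaschke_product B &
    forall z, nrm z <= 1 -> B z = p.[z] / q.[z].
Proof.
move=> [k1 qp pq q0].
have p0 : p != 0.
  have := q0 1; rewrite nrm1 => /(_ (lexx _)).
  rewrite qp ?oner_eq0 //; apply: contraNneq => ->.
  by rewrite horner0 /= rmorph0 mulr0.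
have [rs prs] := closed_field_poly_normal p.
set al := lead_coef p in prs.
have al0 : al != 0 by rewrite lead_coef_eq0.
have kal0 : k * al^* != 0.
  by rewrite mulf_neq0 ?conj_eq0 // -nrm_eq0 k1 oner_eq0.
pose D : {poly R[i]} := \prod_(w <- rs) (1 - w^* *: 'X).
have De z : D.[z] = \prod_(w <- rs) (1 - w^* * z).
  by rewrite horner_prod; apply: eq_bigr => w _; rewrite !hornerE.
have pe z : p.[z] = al * \prod_(w <- rs) (z - w).
  rewrite prs hornerZ horner_prod; congr (_ * _).
  by apply: eq_bigr => w _; rewrite !hornerE.
have D0 : D.[0] = 1.
  by rewrite De big1 // => w _; rewrite mulr0 subr0.
have qD : 'X^(size rs) * q = (k * al^*) *: ('X^(n.+1) * D).
  apply: poly_eq_off0 => z z0; rewrite hornerM hornerZ hornerM !hornerXn qp // pe.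
  rewrite conjM De.
  have -> : (\prod_(w <- rs) ((z^*)^-1 - w))^* = z ^- size rs * \prod_(w <- rs) (1 - w^* * z).
    elim: (rs) => [|w s IH]; first by rewrite !big_nil conj1 expr0 invr1 mulr1.
    rewrite !big_cons conjM IH conjD conjN conjV conjK /= exprS.
    by field; rewrite z0 expf_neq0.
  by field; rewrite expf_neq0.
have szrs : size rs = n.+1.
  apply/eqP; rewrite eqn_leq; apply/andP; split; rewrite leqNgt; apply/negP => lt.
    have : 'X^(size rs - n.+1) * q = (k * al^*) *: D.
      apply: (mulfI (_ : 'X^(n.+1) != 0)); first by rewrite -size_poly_eq0 size_polyXn.
      by rewrite mulrA -exprD subnKC ?(ltnW lt) // qD scalerAr.
    move=> /(congr1 (fun r : {poly R[i]} => r.[0])).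
    rewrite hornerM hornerXn hornerZ D0 expr0n subn_eq0 leqNgt lt mul0r mulr1.
    by move/esym/eqP; rewrite (negbTE kal0).
  have : q = (k * al^*) *: ('X^(n.+1 - size rs) * D).
    apply: (mulfI (_ : 'X^(size rs) != 0)); first by rewrite -size_poly_eq0 size_polyXn.
    by rewrite qD -scalerAr mulrA -exprD subnKC // ltnW.
  move=> /(congr1 (fun r : {poly R[i]} => r.[0])).
  rewrite hornerZ hornerM hornerXn D0 expr0n subn_eq0 leqNgt lt mul0r mulr0.
  by apply/eqP; rewrite q0 // nrm0.
have qE z : q.[z] = k * al^* * \prod_(w <- rs) (1 - w^* * z).
  have -> : q = (k * al^*) *: D.
    apply: (mulfI (_ : 'X^(n.+1) != 0)); first by rewrite -size_poly_eq0 size_polyXn.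
    by rewrite -szrs qD szrs -scalerAr.
  by rewrite hornerZ De.
have rs1 w : w \in rs -> nrm w < 1.
  move=> wrs; rewrite ltNge; apply/negP => w1.
  have w0 : w != 0 by rewrite -nrm_gt0 (lt_le_trans _ w1).
  have := q0 (w^*)^-1; rewrite nrmV nrmJ invf_le1 ?(lt_le_trans _ w1) // => /(_ w1).
  rewrite qE (big_rem w wrs) /= mulfV ?conj_eq0 // subrr mul0r mulr0.
  by rewrite eqxx.
pose zeta : R[i] := al / (k * al^*).
exists (blaschke zeta (fun i : 'I_n.+1 => rs`_i)).
  exists n, (fun i : 'I_n.+1 => rs`_i), zeta; split => //.
    by move=> i; rewrite /unit_disc /= ltc1 rs1 // mem_nth // szrs.
  rewrite /unit_circle /= eqc1 /zeta nrmM nrmV nrmM k1 mul1r nrmJ divff //.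
  by rewrite nrm_eq0.
move=> z z1; rewrite /blaschke qE pe /zeta.
have dz w : w \in rs -> 1 - w^* * z != 0 by move=> /rs1 w1; rewrite nrm_1subM.
have -> : \prod_(i < n.+1) ((z - rs`_i) / (1 - (rs`_i)^* * z)) =
    \prod_(w <- rs) ((z - w) / (1 - w^* * z)).
  by rewrite [RHS](big_nth 0) szrs big_mkord.
by rewrite big_split /= prodfV mulf_div.
Qed.

(** With [t = 1 - rho ^ 2]: [1 - |a| ^ 2 >= 3 / 4] and a denominator of modulus at most 2 give
    [1 - |mobius a z| ^ 2 >= 3 / 16 * t], and the square root halves the constant. *)
Lemma mobius_le_uniform a z (rho : R) : nrm a <= 1 / 2 -> nrm z <= rho -> rho < 1 ->
  nrm (mobius a z) <= 1 - 3 / 32 * (1 - rho ^+ 2).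
Proof.
move=> a2 zr r1; have a0 := nrm_ge0 a; have z0 := nrm_ge0 z.
have rho2 : rho ^+ 2 < 1 by rewrite expr_lt1 // (le_trans z0).
have a1 : nrm a < 1 by lra.
have z1 : nrm z < 1 by lra.
have r20 := sqr_ge0 rho.
set t := 1 - rho ^+ 2 in rho2 *.
have b0 : 0 <= 1 - 3 / 32 * t by rewrite /t; lra.
have d0 : 0 < nrm (1 - a^* * z) by rewrite nrm_gt0 nrm_1subM // ltW.
rewrite /mobius nrmM nrmV ler_pdivrMr //.
apply: nrm_le_abs; first by rewrite mulr_ge0 // ltW.
have := disc_automorphism_identity z a.
have d2 : nrm (1 - a^* * z) <= 2.
  by rewrite (le_trans (nrmB _ _)) // nrm1 nrmM nrmJ; nra.
have dd : nrm (1 - a^* * z) ^+ 2 <= 4 by nra.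
have zz : nrm z ^+ 2 <= rho ^+ 2 by rewrite ler_pXn2r // nnegrE // (le_trans z0).
have aa : nrm a ^+ 2 <= 1 / 4 by nra.
have : t * (3 / 4) <= (1 - nrm z ^+ 2) * (1 - nrm a ^+ 2).
  by apply: ler_pM; rewrite /t; lra.
have t0 : 0 < t by rewrite /t; lra.
have : 3 / 16 * t * nrm (1 - a^* * z) ^+ 2 <= 3 / 16 * t * 4.
  by rewrite ler_wpM2l // mulr_ge0 // ltW.
have := sqr_ge0 (3 / 32 * t * nrm (1 - a^* * z)).
have -> : ((1 - 3 / 32 * t) * nrm (1 - a^* * z)) ^+ 2 =
    nrm (1 - a^* * z) ^+ 2 - 3 / 16 * t * nrm (1 - a^* * z) ^+ 2
    + (3 / 32 * t * nrm (1 - a^* * z)) ^+ 2 by field.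
lra.
Qed.

Lemma caratheodory_approx g (rho e : R) : schur [::] g -> 0 <= rho -> rho < 1 ->
  0 < e -> exists2 B, finite_blaschke_product B &
    forall z, nrm z <= rho -> nrm (B z - g z) <= e.
Proof.
move=> [Hg g1] rho0 rho1 e0.
pose d := Num.min (1 / 2) (e / 2).
have d0 : 0 < d by rewrite lt_min !divr_gt0.
have d2 : d <= 1 / 2 by rewrite ge_min lexx.
have de : d <= e / 2 by rewrite ge_min lexx orbT.
clearbody d.
pose b := 1 - 3 / 32 * (1 - rho ^+ 2).
have rho2 : rho ^+ 2 < 1 by rewrite expr_lt1.
have r20 := sqr_ge0 rho.
have b0 : 0 <= b by rewrite /b; lra.
have b1 : b < 1 by rewrite /b; lra.
(* The interpolation error is at most [2 * b ^+ N.+1], so this leaves [e / 2] for the perturbation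
   of [g]. *)
have [N HN] : exists N, b ^+ N.+1 <= e / 4.
  have : (fun n => b ^+ n) @ \oo --> (0 : R) by apply: cvg_expr; rewrite ger0_norm.
  move=> /cvgrPdist_lt/(_ (e / 4)); rewrite divr_gt0 // => /(_ isT)[N _ HN].
  exists N; have := HN N.+1 (leqnSn N).
  by rewrite /= sub0r normrN ger0_norm ?exprn_ge0 // => /ltW.
(* The shrinking makes the value at the first node strictly less than 1 in modulus, so the
   interpolant has positive degree even if [g] is a unimodular constant. *)
pose f z := (1 - d)%:C * g z.
have Hf : holo_off [::] f := holo_offM (holo_off_cst _ _) Hg.
have n1d : nrm ((1 - d)%:C : R[i]) = 1 - d by rewrite nrm_real_ge0; lra.
have fd z : nrm z < 1 -> nrm (f z) < 1.
  move=> z1; rewrite /f nrmM n1d.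
  by have := g1 z z1; have := nrm_ge0 (g z); nra.
(* Distinct points of modulus at most [1 / 2], so that [mobius_le_uniform] bounds all factors by the
   same [b]. *)
pose node (i : nat) : R[i] := (i.+2%:R^-1)%:C.
pose s := [seq node i | i <- iota 0 N.+1].
have node2 i : nrm (node i) <= 1 / 2.
  rewrite nrm_real_ge0 ?invr_ge0 // div1r lef_pV2 ?posrE ?ltr0n //.
  by rewrite ler_nat.
have us : uniq s.
  rewrite map_inj_uniq ?iota_uniq // => i j /(congr1 (@complex.Re R)) /= /invr_inj.
  by move=> /eqP; rewrite eqr_nat => /eqP [].
have s1 a : a \in s -> nrm a < 1 /\ a \notin [::].
  by move=> /mapP[i _ ->]; split => //; have := node2 i; lra.
have fd1 z : nrm z < 1 -> nrm (f z) <= 1 by move=> z1; rewrite ltW // fd.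
have [p [q [n [k [pq fq n0]]]]] :=
  schur_interpolation (conj Hf fd1) us s1.
have [B HB Bpq] : exists2 B, finite_blaschke_product B &
    forall z, nrm z <= 1 -> B z = p.[z] / q.[z].
  case: n n0 pq => [|n] n0 pq; last exact: inner_pair_blaschke pq.
  have f0 : nrm (f (node 0)) < 1 by apply: fd; have := node2 0%N; lra.
  by have := n0 _ erefl f0.
exists B => // z zr; have z1 : nrm z < 1 by exact: le_lt_trans rho1.
have [k1 qp pq1 q0] := pq.
have q01 w : nrm w < 1 -> q.[w] != 0 by move=> w1; rewrite q0 // ltW.
have Hh : holo_off [::] (fun z => f z - p.[z] / q.[z]).
  exact: (holo_offB Hf (holo_off_div (holo_off_horner _ p) (holo_off_horner _ q)
    q01)).
have Hh2 w : nrm w < 1 -> nrm (f w - p.[w] / q.[w]) <= 2.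
  move=> w1; apply: le_trans (nrmB _ _) _.
  have -> : 2 = 1 + 1 :> R by ring.
  rewrite lerD //; first by rewrite ltW // fd.
  rewrite nrmM nrmV ler_pdivrMr ?mul1r ?pq1 ?nrm_gt0 ?q0 // ltW //.
have hs a : a \in s -> [/\ nrm a < 1, a \notin [::] & f a - p.[a] / q.[a] = 0].
  move=> as_; have [a1 aE] := s1 a as_; split => //.
  by rewrite -fq // mulfK ?subrr // q0 // ltW.
have := zeros_bound Hh Hh2 us hs z1.
have : \prod_(a <- s) nrm (mobius a z) <= b ^+ N.+1.
  rewrite big_map -[X in b ^+ X](size_iota 0 N.+1).
  elim: (iota 0 N.+1) => [|i l IH]; first by rewrite big_nil expr0.
  rewrite big_cons exprS ler_pM ?nrm_ge0 ?prodr_ge0 //.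
    by move=> *; exact: nrm_ge0.
  exact: mobius_le_uniform.
have := g1 z z1; have fg : f z - g z = - d%:C * g z.
  by rewrite /f rmorphB rmorph1 /=; ring.
have nfg : nrm (f z - g z) <= d.
  rewrite fg nrmM nrmN nrm_real_ge0 ?(ltW d0) //.
  by rewrite ler_piMr ?g1 // ltW.
have := nrm_tri (f z) (B z) (g z); rewrite [nrm (B z - f z)]nrmBC Bpq ?(ltW z1) //.
lra.
Qed.

End Caratheodory.

(** * Covering a compact null subset of the circle by small discs *)

Section NullCover.
Variable R : realType.

Lemma null_set_interval_cover (T : set R) (e : R) :
  lebesgue_measure T = 0%E -> 0 < e -> exists a b : nat -> R,
  [/\ forall k, a k <= b k,
      forall t, T t -> exists k, a k < t <= b k &
      forall n, \sum_(k < n) (b k - a k) <= e].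
Proof.
move=> T0 e0.
have : (lebesgue_measure T < e%:E)%E by rewrite T0 lte_fin.
(* Lebesgue measure unfolds to an infimum over countable covers by half-open intervals. *)
move=> /ereal_inf_lt[_ [A [mA TA] <-]] sA.
have H k : exists ab : R * R, [/\ ab.1 <= ab.2, A k `<=` `]ab.1, ab.2]%classic &
    (wlength idfun (A k) = (ab.2 - ab.1)%:E)%E].
  have /ocitvP[->|[[x y] /= xy ->]] := mA k.
    by exists (0, 0); rewrite /= wlength0 subrr; split.
  by exists (x, y); split => //=; [exact: ltW|rewrite wlength_itv_bnd // ltW].
have [ab Hab] := choice H.
exists (fun k => (ab k).1), (fun k => (ab k).2); split.
- by move=> k; have [] := Hab k.
- move=> t /TA[k _ At]; exists k; have [_ s _] := Hab k.
  by have := s _ At; rewrite /= in_itv.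
- move=> n; rewrite -lee_fin -sumEFin (le_trans _ (ltW sA)) //.
  under eq_bigr => k _ do have [_ _ <-] := Hab k.
  rewrite -(big_mkord xpredT (fun k => wlength idfun (A k))).
  by apply: nneseries_lim_ge => k _ _; exact: measure_ge0.
Qed.

Lemma compact_ball_cover (I : choiceType) (K : set R[i]^o) (D : set I)
    (c : I -> R[i]) (d : I -> R) : compact K ->
  (forall z, K z -> exists2 i, D i & nrm (z - c i) < d i) ->
  exists s : seq I, (forall i, i \in s -> D i) /\
    forall z, K z -> exists2 i, i \in s & nrm (z - c i) < d i.
Proof.
rewrite compact_cover => cK KD.
have [||F FD KF] := cK I D (fun i => [set z : R[i]^o | nrm (z - c i) < d i]).
- move=> i _; rewrite openE /= => z zi; apply/nbhs_nrmP.
  exists (d i - nrm (z - c i)); first by rewrite subr_gt0.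
  by move=> w wz /=; have := nrm_tri z w (c i); lra.
- by move=> z /KD[i Di zi]; exists i.
exists (finmap.enum_fset F); split; first by move=> i iF; have := FD i iF; rewrite inE.
by move=> z /KF[i iF zi]; exists i.
Qed.

Lemma unit_circle_angle (z : R[i]) : nrm z = 1 ->
  exists2 t : R, 0 <= t < 2 * pi & z = cos t +i* sin t.
Proof.
move=> z1; have := nrm_sq z; rewrite z1 expr1n; case: z {z1} => x y /= xy.
have x1 : -1 <= x <= 1 by nra.
have px := pi_gt0 R.
have cK : cos (acos x) = x by rewrite acosK // in_itv.
have a0 : 0 <= acos x by rewrite acos_ge0.
have ap : acos x <= pi by rewrite acos_lepi.
have sE : sin (acos x) = `|y|.
  by rewrite sin_acos // -sqrtr_sqr; congr Num.sqrt; lra.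
have [y0|y0] := leP 0 y.
  exists (acos x); first by apply/andP; split; lra.
  by rewrite cK sE ger0_norm.
have an : acos x != 0.
  apply: contraTneq y0 => ax; have := sE; rewrite ax sin0 => /esym/eqP.
  by rewrite normr_eq0 => /eqP ->; rewrite ltxx.
exists (2 * pi - acos x).
  have : 0 < acos x by rewrite lt_def an.
  by move=> h; apply/andP; split; lra.
rewrite mulr_natl cosB sinB cos2pi sin2pi !mul1r !mul0r addr0 sub0r cK sE.
by rewrite ltr0_norm // opprK.
Qed.

Lemma circle_lipschitz (s t : R) :
  nrm ((cos s +i* sin s) - (cos t +i* sin t)) <= 2 * `|s - t|.
Proof.
wlog ts : s t / t <= s => [H|].
  have [/H//|/ltW/H] := leP t s; by rewrite nrmBC distrC.
have dc x : t <= x <= s -> is_derive x 1 (cos : R -> R) (- sin x) by move=> _; exact: is_derive_cos.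
have ds x : t <= x <= s -> is_derive x 1 (sin : R -> R) (cos x) by move=> _; exact: is_derive_sin.
have c1 : `|cos s - cos t| <= 1 * (s - t).
  have := @increment_affine_approx R cos (fun x => - sin x) t s 0 0 0 1 ts dc.
  rewrite !mul0r addr0 subr0; apply => x _.
  by rewrite !mul0r addr0 subr0 normrN ler_norml sin_geN1 sin_le1.
have c2 : `|sin s - sin t| <= 1 * (s - t).
  have := @increment_affine_approx R sin (fun x => cos x) t s 0 0 0 1 ts ds.
  rewrite !mul0r addr0 subr0; apply => x _.
  by rewrite !mul0r addr0 subr0 ler_norml cos_geN1 cos_le1.
apply: le_trans (nrm_le_ReIm _) _; rewrite ReD ReN ImD ImN /=.
rewrite (@ger0_norm _ (s - t)) ?subr_ge0 //; lra.
Qed.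

Lemma nrm_circle (t : R) : nrm (cos t +i* sin t) = 1.
Proof. by have := nrm_polar 0 t; rewrite /polar expR0 !mul1r. Qed.

Lemma null_compact_ball_cover (K : set R[i]^o) (e : R) :
  compact K -> K `<=` unit_circle R -> arclength K = 0%E -> 0 < e ->
  exists s : seq (R[i] * R), [/\ forall p, p \in s -> nrm p.1 = 1 /\ 0 < p.2,
    \sum_(p <- s) p.2 <= e &
    forall z, K z -> exists2 p, p \in s & nrm (z - p.1) < p.2].
Proof.
move=> cK Kc K0 e0; have e2 : 0 < e / 2 by rewrite divr_gt0.
have [a [b [ab Tab sab]]] := null_set_interval_cover K0 e2.
pose m k := (a k + b k) / 2.
pose c k := cos (m k) +i* sin (m k).
(* The slack makes the radius positive even for an empty interval, and sums to less than [e / 2]. *)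
pose d k := b k - a k + e / 2 / 2 ^+ k.+1.
have e2k k : 0 < e / 2 / 2 ^+ k.+1 by rewrite divr_gt0 // exprn_gt0.
have dab k : b k - a k < d k by rewrite /d ltrDl.
have d0 k : 0 < d k by rewrite (le_lt_trans _ (dab k)) // subr_ge0.
have cov z : K z -> exists2 k, setT k & nrm (z - c k) < d k.
  move=> Kz; have /eqc1 z1 := Kc z Kz; have [t t2 zt] := unit_circle_angle z1.
  have [|k tk] := Tab t; first by rewrite /= -zt.
  exists k => //; apply: le_lt_trans (dab k); rewrite zt.
  apply: le_trans (circle_lipschitz _ _) _.
  (* Measuring from the midpoint gains the factor 2 lost in [circle_lipschitz]. *)
  have : `|t - m k| <= (b k - a k) / 2 by rewrite ler_norml /m; lra.
  lra.
have [s [_ Hs]] := compact_ball_cover cK cov.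
pose n := (\max_(k <- s) k).+1.
(* A whole initial segment of indices, so that the bound [sab] on partial sums applies without
   regard to repetitions in [s]. *)
exists [seq (c k, d k) | k <- iota 0 n]; split.
- by move=> _ /mapP[k _ ->]; split; [exact: nrm_circle|exact: d0].
- rewrite big_map -[iota 0 n]/(index_iota 0 n) big_mkord /= big_split /=.
  have g k : \sum_(i < k) e / 2 / 2 ^+ i.+1 = e / 2 - e / 2 / 2 ^+ k.
    elim: k => [|k IH]; first by rewrite big_ord0 expr0 divr1 subrr.
    by rewrite big_ord_recr /= IH exprS; field; rewrite expf_neq0.
  rewrite g; have := sab n.
  have : 0 < e / 2 / 2 ^+ n by rewrite divr_gt0 // exprn_gt0.
  lra.
- move=> z /Hs[k ks zk]; exists (c k, d k) => //.
  apply/mapP; exists k => //; rewrite mem_iota /= add0n /n ltnS.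
  exact: leq_bigmax_seq.
Qed.

End NullCover.

(** * From the half-plane to a half strip; bumps at boundary points *)

Section HalfPlane.
Variable R : realType.
Implicit Types (F q z w : R[i]).

Lemma Re_inv q : complex.Re q^-1 = complex.Re q / nrm q ^+ 2.
Proof.
have [->|q0] := eqVneq q 0; first by rewrite invr0 mul0r.
have n0 : nrm q != 0 by rewrite nrm_eq0.
have -> : q^-1 = (nrm q ^- 2)%:C * q^*.
  apply: (mulfI q0); rewrite mulfV // mulrCA mulJ -rmorphM /=.
  by rewrite mulVf // expf_neq0.
by rewrite conjE; case: q {q0 n0} => a b; rewrite ReM /= mul0r subr0 mulrC.
Qed.

Lemma shift_neq0 (s : R) F : 0 < s -> 0 <= complex.Re F -> s%:C + F != 0.
Proof.
move=> s0 F0; apply/negP => /eqP /(congr1 (@complex.Re R)).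
by rewrite ReD /=; lra.
Qed.

Lemma shift_eq (s : R) F (u := F / (s%:C + F)) (x := complex.Re F)
    (y := complex.Im F) (D := (s + x) ^+ 2 + y ^+ 2) :
  0 < s -> 0 <= complex.Re F ->
  complex.Re u * D = x * (s + x) + y ^+ 2 /\ complex.Im u * D = s * y.
Proof.
move=> s0 F0; have d0 := shift_neq0 s0 F0.
have e : u * (s%:C + F) = F by rewrite /u divfK.
have := congr1 (@complex.Re R) e; have := congr1 (@complex.Im R) e.
rewrite ReM ImM ReD ImD /= add0r -/x -/y => e2 e1; rewrite /D; split.
  transitivity ((s + x) * (complex.Re u * (s + x) - complex.Im u * y) +
    y * (complex.Re u * y + complex.Im u * (s + x))); first by ring.
  by rewrite e1 e2; ring.
transitivity ((s + x) * (complex.Re u * y + complex.Im u * (s + x)) -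
   y * (complex.Re u * (s + x) - complex.Im u * y)); first by ring.
by rewrite e1 e2; ring.
Qed.

(* The bound on Im u is shaped to telescope along s = 2 ^ k. *)
Lemma shift_bounds (s : R) F (u := F / (s%:C + F)) (Y := `|complex.Im F|) :
  0 < s -> 0 <= complex.Re F ->
  [/\ 0 <= complex.Re u,
      `|complex.Im u| <= 7 / 2 * (2 * s / (2 * s + Y) - s / (s + Y)),
      nrm u <= nrm F / s &
      s <= complex.Re F -> 1 / 2 <= complex.Re u].
Proof.
move=> s0 F0; have [] := shift_eq s0 F0; rewrite -/u.
set x := complex.Re F in F0 *; set y := complex.Im F in Y *.
set D := (s + x) ^+ 2 + y ^+ 2 => e1 e2.
have y20 := sqr_ge0 y.
have D0 : 0 < D by rewrite ltr_pwDl // exprn_gt0 //; lra.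
have Y0 : 0 <= Y by rewrite normr_ge0.
have Y2 : Y ^+ 2 = y ^+ 2 by rewrite /Y real_normK ?num_real.
split.
- by rewrite -(pmulr_lge0 _ D0) e1; nra.
- have a1 : `|complex.Im u| * D = s * Y.
    by rewrite -[D in LHS](gtr0_norm D0) -normrM e2 normrM (gtr0_norm s0).
  have sY : 0 < s + Y by lra.
  have s2Y : 0 < 2 * s + Y by lra.
  have -> : 7 / 2 * (2 * s / (2 * s + Y) - s / (s + Y)) =
      7 / 2 * (s * Y) / ((2 * s + Y) * (s + Y)).
    by field; rewrite !gt_eqF.
  rewrite ler_pdivlMr ?mulr_gt0 // -a1.
  rewrite [leRHS]mulrC -mulrA ler_wpM2l ?normr_ge0 //.
  (* The constant comes from [3 s Y <= 3 / 2 * (s ^ 2 + Y ^ 2)] in the expansion of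
     [(2 s + Y) (s + Y)], together with [s + x >= s]. *)
  have -> : D * (7 / 2) = 7 / 2 * ((s + x) ^+ 2 + Y ^+ 2) by rewrite /D Y2 mulrC.
  have := sqr_ge0 (s - Y); nra.
- rewrite /u nrmM nrmV ler_wpM2l ?nrm_ge0 // lef_pV2 ?posrE //; last first.
    by rewrite nrm_gt0 shift_neq0.
  by apply: le_trans (Re_le _); rewrite ReD /= lerDl.
- move=> sx; rewrite -(ler_pM2r D0) e1 /D; nra.
Qed.

(* A rational substitute for log (1 + F): the right half-plane goes to a half
   strip Re w >= 0, |Im w| <= 4, where |w| <= Re w + 4, so that complex weights
   w of this form average almost like nonnegative ones. *)
Definition strip_map (n : nat) F : R[i] :=
  \sum_(k < n) F / ((2 ^+ k)%:C + F).

(** Imaginary parts telescope to at most [7 / 2], moduli form a geometric series, and once [Re F]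
    exceeds every [2 ^ k] used, each of the [n] terms has real part at least [1 / 2]. *)
Lemma strip_map_bounds n F : 0 <= complex.Re F ->
  [/\ 0 <= complex.Re (strip_map n F), `|complex.Im (strip_map n F)| <= 4,
      nrm (strip_map n F) <= 2 * nrm F &
      2 ^+ n <= complex.Re F -> n%:R / 2 <= complex.Re (strip_map n F)].
Proof.
move=> F0; have s0 k : 0 < 2 ^+ k :> R by rewrite exprn_gt0.
have B k := shift_bounds (s0 k) F0.
have n0 := nrm_ge0 F.
rewrite /strip_map; split.
- by rewrite Re_sum sumr_ge0 // => k _; have [] := B k.
- rewrite Im_sum; set Y := `|complex.Im F|.
  have Y0 : 0 <= Y by rewrite normr_ge0.
  have sY (s : R) : 0 < s -> 0 <= s / (s + Y) <= 1.
    move=> ss; apply/andP; split; first by rewrite divr_ge0 //; lra.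
    by rewrite ler_pdivrMr ?mul1r; lra.
  have : `|\sum_(k < n) complex.Im (F / ((2 ^+ k)%:C + F))|
      <= 7 / 2 * (2 ^+ n / (2 ^+ n + Y) - 2 ^+ 0 / (2 ^+ 0 + Y)).
    elim: n => [|n IH]; first by rewrite big_ord0 normr0 subrr mulr0.
    rewrite big_ord_recr /= (le_trans (ler_normD _ _)) //.
    by have [_ + _ _] := B n; rewrite -exprS -/Y => h; lra.
  have := sY _ (s0 n); have := sY _ (s0 0%N); lra.
- apply: le_trans (nrm_sum _ _ _) _.
  have : \sum_(k < n) nrm (F / ((2 ^+ k)%:C + F)) <= 2 * nrm F - 2 * nrm F / 2 ^+ n.
    elim: n => [|n IH]; first by rewrite big_ord0 expr0 divr1 subrr.
    rewrite big_ord_recr /=; have [_ _ h _] := B n.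
    have -> : 2 * nrm F - 2 * nrm F / 2 ^+ n.+1 =
        (2 * nrm F - 2 * nrm F / 2 ^+ n) + nrm F / 2 ^+ n.
      by rewrite exprS; field; rewrite expf_neq0.
    exact: lerD.
  have : 0 <= 2 * nrm F / 2 ^+ n by rewrite divr_ge0 ?mulr_ge0 // ltW.
  lra.
- move=> nF; rewrite Re_sum.
  have -> : n%:R / 2 = \sum_(k < n) (1 / 2) :> R.
    by rewrite sumr_const card_ord -[RHS]mulr_natl div1r.
  apply: ler_sum => k _; have [_ _ _ h] := B k; apply: h.
  by apply: le_trans nF; rewrite ler_weXn2l ?ler1n // ltnW.
Qed.

Lemma holo_off_strip_map E n (G : R[i] -> R[i]) : holo_off E G ->
  (forall z, nrm z < 1 -> 0 <= complex.Re (G z)) ->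
  holo_off E (fun z => strip_map n (G z)).
Proof.
move=> HG G0; rewrite /strip_map.
apply: (@holo_off_sum R E 'I_n _ xpredT (fun k z => G z / ((2 ^+ k)%:C + G z))) => k _.
apply: (holo_off_div HG (holo_offD (holo_off_cst _ _) HG)) => z z1.
by rewrite shift_neq0 ?G0 // exprn_gt0.
Qed.

(** For unimodular [zeta] and [d > 0] the pole sits just outside the disc, at [(1 + d) zeta], and
    the value at [zeta] is 1. *)
Definition bump (zeta : R[i]) (d : R) w : R[i] := d%:C / (1 + d%:C - zeta^* * w).

Section Bump.
Variables (zeta : R[i]) (d : R).
Hypotheses (z1 : nrm zeta = 1) (d0 : 0 < d).

Let Re_den w : nrm w <= 1 -> d <= complex.Re (1 + d%:C - zeta^* * w).
Proof.
move=> w1; have : complex.Re (zeta^* * w) <= 1.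
  by apply: le_trans (Re_le _) _; rewrite nrmM nrmJ z1 mul1r.
by rewrite !ReD ReN /=; lra.
Qed.

Let nrm_zeta w : nrm (1 - zeta^* * w) = nrm (w - zeta).
Proof.
have -> : 1 - zeta^* * w = - (zeta^* * (w - zeta)).
  by rewrite mulrBr [zeta^* * zeta]mulrC mulJ z1 expr1n opprB.
by rewrite nrmN nrmM nrmJ z1 mul1r.
Qed.

Let den_neq0 w : nrm w <= 1 -> 1 + d%:C - zeta^* * w != 0.
Proof.
move=> /Re_den w1; apply/negP => /eqP e; move: w1.
by rewrite e => /(lt_le_trans d0); rewrite ltxx.
Qed.

Lemma holo_off_bump E : holo_off E (bump zeta d).
Proof.
have d1 z : nrm z < 1 -> 1 + d%:C - zeta^* * z != 0.
  by move=> zz; rewrite den_neq0 // ltW.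
exact: (holo_off_div (holo_off_cst E _) (holo_offB (holo_off_cst E _)
  (holo_offM (holo_off_cst E _) (holo_off_id E))) d1).
Qed.

Lemma Re_bump w :
  complex.Re (bump zeta d w) = d * complex.Re (1 + d%:C - zeta^* * w) /
    nrm (1 + d%:C - zeta^* * w) ^+ 2.
Proof. by rewrite /bump ReM Re_inv /= mul0r subr0 mulrA. Qed.

Lemma Re_bump_ge0 w : nrm w <= 1 -> 0 <= complex.Re (bump zeta d w).
Proof.
move=> /Re_den w1; rewrite Re_bump divr_ge0 ?sqr_ge0 // mulr_ge0 ?(ltW d0) //.
exact: le_trans (ltW d0) w1.
Qed.

(** The denominator has real part at least [d] and modulus at most [3 d], whence
    [d * d / (3 d) ^ 2]. The radius [2 d] leaves a margin [d] for the dilation of a point covered at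
    radius [d]. *)
Lemma Re_bump_near w : nrm w <= 1 -> nrm (w - zeta) <= 2 * d ->
  1 / 9 <= complex.Re (bump zeta d w).
Proof.
move=> w1 wz; have Rd := Re_den w1.
have n0 : 0 < nrm (1 + d%:C - zeta^* * w) by rewrite nrm_gt0 den_neq0.
have n3 : nrm (1 + d%:C - zeta^* * w) <= 3 * d.
  have -> : 1 + d%:C - zeta^* * w = (1 - zeta^* * w) + d%:C by ring.
  rewrite (le_trans (nrmD _ _)) // nrm_zeta nrm_real_ge0 ?(ltW d0) //; lra.
rewrite Re_bump ler_pdivlMr ?exprn_gt0 //.
have : nrm (1 + d%:C - zeta^* * w) ^+ 2 <= (3 * d) ^+ 2.
  by rewrite ler_pXn2r // nnegrE ltW // mulr_gt0.
have : d * d <= d * complex.Re (1 + d%:C - zeta^* * w) by rewrite ler_wpM2l // ltW.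
rewrite exprMn; lra.
Qed.

(** Adding [d] to [1 - zeta^* w], whose real part is nonnegative, only increases its modulus
    [|w - zeta|]. *)
Lemma bump_far w (D : R) : nrm w <= 1 -> 0 < D -> D <= nrm (w - zeta) ->
  nrm (bump zeta d w) <= d / D.
Proof.
move=> w1 D0 Dw; rewrite /bump nrmM nrmV nrm_real_ge0 ?(ltW d0) //.
rewrite ler_pM2l // lef_pV2 ?posrE //; last by rewrite nrm_gt0 den_neq0.
apply: le_trans Dw _; rewrite -nrm_zeta.
apply: nrm_le_abs; first exact: nrm_ge0.
have := Re_den w1; rewrite !nrm_sq !ReD !ImD ReN ImN /=.
set x := complex.Re (zeta^* * w); set y := complex.Im (zeta^* * w) => h.
have : 0 <= d * (1 - x) by rewrite mulr_ge0 ?(ltW d0) //; lra.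
have := sqr_ge0 d; nra.
Qed.

End Bump.
End HalfPlane.

(** * Averages with complex weights in a half strip *)

Section WeightedAverage.
Variables (R : realType) (T : eqType) (s : seq T) (v w : T -> R[i]) (A e : R).
Hypotheses (A0 : 0 < A) (e0 : 0 < e) (e1 : e <= 1).
Hypothesis v1 : forall j, j \in s -> nrm (v j) <= 1.
Hypothesis w0 : forall j, j \in s -> 0 <= complex.Re (w j).
Hypothesis w4 : forall j, j \in s -> `|complex.Im (w j)| <= 4.
Hypothesis sA : 4 * (size s)%:R <= e * A.

Lemma sum_le_size (F : T -> R) (c : R) : (forall j, j \in s -> F j <= c) ->
  \sum_(j <- s) F j <= c * (size s)%:R.
Proof.
move=> H; rewrite big_seq; apply: le_trans (ler_sum _ H) _.
by rewrite -big_seq big_const_seq count_predT iter_addr_0 mulr_natr.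
Qed.

Definition wavg (y : R[i]) : R[i] :=
  (A%:C * y + \sum_(j <- s) v j * w j) / (A%:C + \sum_(j <- s) w j).

Let S := A + \sum_(j <- s) complex.Re (w j).

Let S_ge : A <= S.
Proof. by rewrite lerDl big_seq sumr_ge0. Qed.

Let den_ge : S <= nrm (A%:C + \sum_(j <- s) w j).
Proof. by apply: le_trans (Re_le _); rewrite ReD Re_sum. Qed.

Lemma wavg_den_gt0 : 0 < nrm (A%:C + \sum_(j <- s) w j).
Proof. exact: lt_le_trans A0 (le_trans S_ge den_ge). Qed.

(** Each modulus exceeds the real part by at most 4, and [sA] charges the total excess to the fixed
    weight [A]. *)
Let sum_nrm : \sum_(j <- s) nrm (w j) <= S - A + e * A.
Proof.
have : \sum_(j <- s) (nrm (w j) - complex.Re (w j)) <= 4 * (size s)%:R.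
  apply: sum_le_size => j js; rewrite lerBlDl.
  apply: le_trans (nrm_le_ReIm _) _.
  by rewrite (ger0_norm (w0 js)) lerD2l w4.
rewrite sumrB => /le_trans/(_ sA); rewrite lerBlDr => h.
by rewrite /S [A + _]addrC addrK addrC.
Qed.

Lemma nrm_wavg y : nrm y <= 1 -> nrm (wavg y) <= 1 + e.
Proof.
move=> y1; rewrite /wavg nrmM nrmV ler_pdivrMr ?wavg_den_gt0 //.
apply: le_trans (_ : (1 + e) * S <= _); last first.
  by rewrite ler_wpM2l ?den_ge // addr_ge0 // ltW.
apply: le_trans (nrmD _ _) _.
have h1 : nrm (A%:C * y) <= A by rewrite nrmM nrm_real_ge0 ?(ltW A0) // ler_piMr // ltW.
have h2 : nrm (\sum_(j <- s) v j * w j) <= \sum_(j <- s) nrm (w j).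
  apply: le_trans (nrm_sum _ _ _) _; rewrite !big_seq; apply: ler_sum => j js.
  by rewrite nrmM ler_piMl ?nrm_ge0 // v1.
rewrite (le_trans (lerD h1 (le_trans h2 sum_nrm))) // addrA addrCA subrr addr0.
by rewrite mulrDl mul1r lerD2l ler_wpM2l // ltW.
Qed.

Let wavg_sub y t : wavg y - t =
  (A%:C * (y - t) + \sum_(j <- s) (v j - t) * w j) / (A%:C + \sum_(j <- s) w j).
Proof.
have d0 : A%:C + \sum_(j <- s) w j != 0 by rewrite -nrm_gt0 wavg_den_gt0.
have -> : \sum_(j <- s) (v j - t) * w j =
    \sum_(j <- s) v j * w j - t * \sum_(j <- s) w j.
  by rewrite mulr_sumr -sumrB; apply: eq_bigr => j _; rewrite mulrBl.
rewrite /wavg; move: (\sum_(j <- s) v j * w j) (\sum_(j <- s) w j) d0 => V W d0.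
by field.
Qed.

(** Each index contributes at most [2 * 2] to the numerator; [sA] bounds the total by [e * A], while
    the denominator is at least [A]. *)
Lemma wavg_far y : nrm y <= 1 -> (forall j, j \in s -> nrm (w j) <= 2) ->
  nrm (wavg y - y) <= e.
Proof.
move=> y1 w2; rewrite wavg_sub subrr mulr0 add0r nrmM nrmV ler_pdivrMr ?wavg_den_gt0 //.
apply: le_trans (_ : e * A <= _); last first.
  by rewrite ler_wpM2l ?(ltW e0) // (le_trans S_ge).
apply: le_trans (nrm_sum _ _ _) _; apply: le_trans sA.
apply: sum_le_size => j js; rewrite nrmM.
have -> : 4 = 2 * 2 :> R by ring.
apply: ler_pM; rewrite ?nrm_ge0 ?w2 // (le_trans (nrmB _ _)) //.
by have := v1 js; lra.
Qed.

(** One large weight pushes [S] above [3 A / e], so both the share of [y] and the indices with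
    bounded weight become negligible; the other values are already within [e] of [t]. *)
Lemma wavg_near y t : nrm y <= 1 -> nrm t <= 1 ->
  (forall j, j \in s -> nrm (v j - t) <= e \/ nrm (w j) <= 2) ->
  (exists2 j, j \in s & 3 * A <= e * complex.Re (w j)) ->
  nrm (wavg y - t) <= 3 * e.
Proof.
move=> y1 t1 vw [j0 js0 j0A].
have SA : 3 * A <= e * S.
  apply: le_trans j0A _; rewrite ler_wpM2l ?(ltW e0) //.
  rewrite /S (big_rem j0) //= addrCA lerDl addr_ge0 ?(ltW A0) //.
  by rewrite big_seq sumr_ge0 // => j /mem_rem /w0.
rewrite wavg_sub nrmM nrmV ler_pdivrMr ?wavg_den_gt0 //.
apply: le_trans (_ : 3 * e * S <= _); last first.
  by rewrite ler_wpM2l // mulr_ge0 // ltW.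
apply: le_trans (nrmD _ _) _.
have h1 : nrm (A%:C * (y - t)) <= 2 * A.
  rewrite nrmM nrm_real_ge0 ?(ltW A0) // mulrC ler_wpM2r ?(ltW A0) //.
  by rewrite (le_trans (nrmB _ _)) //; lra.
have h2 : nrm (\sum_(j <- s) (v j - t) * w j) <=
    e * (\sum_(j <- s) nrm (w j)) + 4 * (size s)%:R.
  apply: le_trans (nrm_sum _ _ _) _; rewrite -lerBlDl mulr_sumr -sumrB.
  apply: sum_le_size => j js; rewrite nrmM lerBlDl.
  have a0 := nrm_ge0 (w j); have b0 := nrm_ge0 (v j - t).
  have ea : 0 <= e * nrm (w j) by rewrite mulr_ge0 // ltW.
  have [h|h] := vw j js.
    by apply: le_trans (ler_wpM2r a0 h) _; rewrite lerDl.
  apply: le_trans (_ : 4 <= _); last by rewrite lerDr.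
  have -> : 4 = 2 * 2 :> R by ring.
  apply: ler_pM => //; rewrite (le_trans (nrmB _ _)) //.
  by have := v1 js; lra.
have h3 : e * (\sum_(j <- s) nrm (w j)) <= e * (S - A + e * A).
  by rewrite ler_wpM2l ?sum_nrm // ltW.
have h4 : e * (e * A) <= e * A by rewrite ler_piMl // mulr_ge0 // ltW.
have h5 : e * A <= A by rewrite ler_piMl // ltW.
have ee : e * (S - A + e * A) = e * S - e * A + e * (e * A) by ring.
rewrite ee in h3.
(* Products such as [e * S] and [e * A] are abstracted into variables to leave a linear problem. *)
have fin (x1 x2 x3 x5 x6 x7 x8 : R) : x2 <= 2 * A -> x1 <= x3 + x7 ->
  x3 <= x5 - x6 + x8 -> 3 * A <= x5 -> x7 <= x6 -> x8 <= x6 -> x6 <= A ->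
  x2 + x1 <= 3 * x5.
  by have := A0; lra.
rewrite -mulrA; exact: (fin _ _ _ _ _ _ _ h1 h2 h3 SA sA h4 h5).
Qed.

End WeightedAverage.

Lemma min_on_seq (R : realType) (T : eqType) (s : seq T) (d : T -> R) :
  (forall i, i \in s -> 0 < d i) ->
  exists2 m, 0 < m & forall i, i \in s -> m <= d i.
Proof.
elim: s => [|i s IH] H; first by exists 1.
have [m m0 Hm] : exists2 m, 0 < m & forall i, i \in s -> m <= d i.
  by apply: IH => j js; apply: H; rewrite inE js orbT.
exists (Num.min m (d i)); first by rewrite lt_min m0 H // mem_head.
move=> j; rewrite inE => /predU1P[->|/Hm h]; rewrite ge_min ?lexx ?orbT //.
by rewrite h.
Qed.

(** * Sums of bumps over a family of discs *)

Section BumpSum.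
Variables (R : realType) (arcs : seq (R[i] * R)) (M D : R).
Hypotheses (M0 : 0 < M) (D0 : 0 < D).
Hypothesis arcsP : forall p, p \in arcs -> nrm p.1 = 1 /\ 0 < p.2.
Hypothesis arcs_sum : \sum_(p <- arcs) p.2 <= D / M.

Definition bump_sum (P : pred (R[i] * R)) (z : R[i]) : R[i] :=
  M%:C * \sum_(p <- arcs | P p) bump p.1 p.2 z.

Lemma holo_off_bump_sum E P : holo_off E (bump_sum P).
Proof.
apply: (holo_offM (holo_off_cst E _)).
apply: (@holo_off_sum R E _ arcs P (fun p => bump p.1 p.2)) => p /arcsP[p1 p2].
exact: holo_off_bump.
Qed.

Let ReE P z : complex.Re (bump_sum P z) =
  M * \sum_(p <- arcs | P p) complex.Re (bump p.1 p.2 z).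
Proof. by rewrite /bump_sum ReM Re_sum /= mul0r subr0. Qed.

Lemma Re_bump_sum_ge0 P z : nrm z <= 1 -> 0 <= complex.Re (bump_sum P z).
Proof.
move=> z1; rewrite ReE mulr_ge0 ?(ltW M0) // big_seq_cond sumr_ge0 //.
by move=> p /andP[/arcsP[p1 p2] _]; exact: Re_bump_ge0.
Qed.

Lemma Re_bump_sum_near (P : pred (R[i] * R)) z p : nrm z <= 1 -> p \in arcs -> P p ->
  nrm (z - p.1) <= 2 * p.2 -> M / 9 <= complex.Re (bump_sum P z).
Proof.
move=> z1 pa Pp zp; have [p1 p2] := arcsP pa.
rewrite ReE ler_pM2l // (big_rem p) //= Pp.
have := Re_bump_near p1 p2 z1 zp; rewrite div1r => h.
apply: le_trans h _; rewrite lerDl big_seq_cond sumr_ge0 //.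
by move=> q /andP[/mem_rem/arcsP[q1 q2] _]; exact: Re_bump_ge0.
Qed.

(** Every bump is at most [p.2 / D], and [arcs_sum] makes [M] times the sum of these at most 1. *)
Lemma bump_sum_far (P : pred (R[i] * R)) z : nrm z <= 1 ->
  (forall p, p \in arcs -> P p -> D <= nrm (z - p.1)) ->
  nrm (bump_sum P z) <= 1.
Proof.
move=> z1 far; rewrite /bump_sum nrmM nrm_real_ge0 ?(ltW M0) //.
rewrite mulrC -ler_pdivlMr // div1r.
apply: le_trans (nrm_sum _ _ _) _.
apply: le_trans (_ : (\sum_(p <- arcs) p.2) / D <= _); last first.
  by rewrite ler_pdivrMr // mulrC.
rewrite mulr_suml big_mkcond big_seq [leRHS]big_seq; apply: ler_sum => p pa.
have [p1 p2] := arcsP pa.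
case: ifP => Pp; last by rewrite divr_ge0 // ltW.
by apply: bump_far => //; exact: far.
Qed.

End BumpSum.

(** * A Schur function close to [phi] near [K] and to [f] inside *)

Section BoundaryApprox.
Variable R : realType.

Lemma schur_boundary_approx (K : set R[i]^o) (phi : R[i]^o -> R[i]^o)
    (f : R[i] -> R[i]) (rho e : R) :
  compact K -> K `<=` unit_circle R -> arclength K = 0%E ->
  {within K, continuous phi} -> (forall z, K z -> nrm (phi z) <= 1) ->
  schur [::] f -> 0 <= rho -> rho < 1 -> 0 < e ->
  exists g r0, [/\ schur [::] g, 0 < r0 < 1,
    forall r, r0 < r < 1 -> forall z, K z -> nrm (g (r%:C * z) - phi z) <= e &
    forall z, nrm z <= rho -> nrm (g z - f z) <= e].
Proof.
move=> cK Kc K0 cphi phi1 [Hf f1] rho0 rho1 e0.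
(* The largest total is [4 * e1]: [3 * e1] from [wavg_near] and [e1] from the normalisation of
   [g0]. *)
pose e1 := Num.min 1 (e / 5).
have e10 : 0 < e1 by rewrite lt_min ltr01 divr_gt0.
have e11 : e1 <= 1 by rewrite ge_min lexx.
have e1e : e1 <= e / 5 by rewrite ge_min lexx orbT.
clearbody e1.
(* The discs attached to [j] have centres within [2 * delta j] of it. A point of [K] at distance at
   least [4 * delta j] from [j] is thus [2 * delta j] away from these centres, of which dilation
   uses up at most one [delta j]. *)
have /choice[delta Hdelta] : forall s : R[i], exists d : R, K s -> 0 < d /\
    forall z, K z -> nrm (z - s) < 4 * d -> nrm (phi z - phi s) <= e1.
  move=> s; have [Ks|nKs] := pselect (K s); last by exists 1.
  have /(_ s Ks) cs := (subspace_continuousP _ _).1 cphi.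
  have /cs : nbhs (phi s) [set w : R[i]^o | nrm (w - phi s) < e1].
    by apply/nbhs_nrmP; exists e1.
  rewrite /nbhs /= /within /= => /nbhs_nrmP[d d0 dH].
  exists (d / 4) => _; split; first by rewrite divr_gt0.
  move=> z Kz zs; apply: ltW; apply: (dH z) => //.
  by rewrite mulrC divfK in zs.
have covK z : K z -> exists2 s, K s & nrm (z - s) < delta s.
  move=> Kz; exists z => //; rewrite subrr nrm0.
  by have [] := Hdelta z Kz.
have [ss [ssK ssP]] := compact_ball_cover cK covK.
have ssd j : j \in ss -> 0 < delta j by move=> /ssK /Hdelta[].
have [dm dm0 Hdm] := min_on_seq ssd.
(* The quotient secures [sA]; the added 1 keeps [A] positive when [ss] is empty. *)
pose A : R := 4 * (size ss)%:R / e1 + 1.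
have A0 : 0 < A.
  by rewrite ltr_wpDl // divr_ge0 ?(ltW e10) // mulr_ge0 // ler0n.
have sA : 4 * (size ss)%:R <= e1 * A.
  by rewrite /A mulrDr [e1 * (_ / _)]mulrC divfK ?gt_eqF // mulr1 lerDl ltW.
clearbody A.
(* Near [K] some weight must have real part [3 * A / e1], while [strip_map n] guarantees [n / 2]
   where [Re F >= 2 ^ n]; the 9 in [M] below undoes the [1 / 9] of [Re_bump_near]. *)
have [n Hn] : exists n : nat, 3 * A <= e1 * (n%:R / 2).
  exists (Num.bound (6 * A / e1)).
  have : 6 * A / e1 < (Num.bound (6 * A / e1))%:R.
    by apply: archi_boundP; rewrite divr_ge0 ?(ltW e10) // mulr_ge0 // ltW.
  by rewrite ltr_pdivrMr //; lra.
pose M : R := 9 * 2 ^+ n.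
have M0 : 0 < M by rewrite mulr_gt0 // exprn_gt0.
have M9 : M / 9 = 2 ^+ n by rewrite /M mulrC mulKf.
(* Distance to the centres in both far cases: from dilated points of [K] for unrelated [j], and from
   the disc of radius [rho]. *)
pose D := Num.min dm (1 - rho).
have D0 : 0 < D by rewrite lt_min dm0 subr_gt0.
have Ddm : D <= dm by rewrite ge_min lexx.
have Drho : D <= 1 - rho by rewrite ge_min lexx orbT.
clearbody D.
have [arcs [arcsP arcs_sum arcs_cov]] :=
  null_compact_ball_cover cK Kc K0 (divr_gt0 D0 M0).
have arcs_dm p : p \in arcs -> p.2 <= dm.
  move=> pa; apply: le_trans Ddm; apply: le_trans (_ : D / M <= _).
    apply: le_trans arcs_sum; rewrite (big_rem p) //= lerDl big_seq sumr_ge0 //.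
    by move=> q /mem_rem/arcsP[_ /ltW].
  rewrite ler_pdivrMr // ler_peMr ?(ltW D0) // /M.
  have : 1 <= 2 ^+ n :> R by rewrite exprn_ege1 // ler1n.
  lra.
have [am am0 Ham] := min_on_seq (fun p pa => (arcsP p pa).2).
(* The radius [2 * delta j] is one [delta j] for the distance from [z] to [j] and one for that from
   [z] to the centre of the disc covering it. *)
pose F j := bump_sum arcs M (fun p => nrm (p.1 - j) < 2 * delta j).
pose w z j := strip_map n (F j z).
have HF j : holo_off [::] (F j) by exact: holo_off_bump_sum.
have F0 j z : nrm z <= 1 -> 0 <= complex.Re (F j z).
  exact: Re_bump_sum_ge0.
have W z j : nrm z <= 1 -> _ := fun z1 => strip_map_bounds n (F0 j z z1).
have w0 z j : nrm z <= 1 -> j \in ss -> 0 <= complex.Re (w z j).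
  by move=> z1 _; have [] := W z j z1.
have w4 z j : nrm z <= 1 -> j \in ss -> `|complex.Im (w z j)| <= 4.
  by move=> z1 _; have [] := W z j z1.
have v1 j : j \in ss -> nrm (phi j) <= 1 by move=> /ssK; exact: phi1.
have w2 z j : nrm z <= 1 -> (forall p, p \in arcs ->
    nrm (p.1 - j) < 2 * delta j -> D <= nrm (z - p.1)) -> nrm (w z j) <= 2.
  move=> z1 far; have [_ _ h _] := W z j z1.
  have : nrm (F j z) <= 1 by exact: (bump_sum_far M0 D0 arcsP arcs_sum).
  by move: h; rewrite -/(w z j); lra.
pose g0 z := wavg ss phi (w z) A (f z).
have Hw j : holo_off [::] (fun z => w z j).
  by apply: (holo_off_strip_map n (HF j)) => z z1; exact: F0 (ltW z1).
have Hg0 : holo_off [::] g0.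
  have H1 : holo_off [::] (fun z => \sum_(j <- ss) phi j * w z j).
    apply: (@holo_off_sum R [::] _ ss xpredT (fun j z => phi j * w z j)) => j _.
    exact: (holo_offM (holo_off_cst _ _) (Hw j)).
  have H2 : holo_off [::] (fun z => \sum_(j <- ss) w z j).
    by apply: (@holo_off_sum R [::] _ ss xpredT (fun j z => w z j)) => j _; exact: Hw.
  apply: (holo_off_div (holo_offD (holo_offM (holo_off_cst _ _) Hf) H1)
    (holo_offD (holo_off_cst _ _) H2)) => z z1.
  rewrite -nrm_gt0; apply: wavg_den_gt0 => // j js.
  exact: w0 (ltW z1) js.
have g0le z : nrm z < 1 -> nrm (g0 z) <= 1 + e1.
  move=> z1; have z1' := ltW z1; apply: nrm_wavg => //.
  - by move=> j; exact: w0.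
  - by move=> j; exact: w4.
  - exact: f1.
(* Restores the bound 1 exactly, at a cost of at most [e1]. *)
pose g z := ((1 + e1)^-1)%:C * g0 z.
have i0 : 0 < 1 + e1 by rewrite addr_gt0.
have ni : nrm (((1 + e1)^-1)%:C : R[i]) = (1 + e1)^-1.
  by rewrite nrm_real_ge0 // invr_ge0 ltW.
have Hg : holo_off [::] g := holo_offM (holo_off_cst _ _) Hg0.
have g1 z : nrm z < 1 -> nrm (g z) <= 1.
  by move=> z1; rewrite /g nrmM ni mulrC ler_pdivrMr // mul1r g0le.
have gg0 z : nrm z < 1 -> nrm (g z - g0 z) <= e1.
  move=> z1; have -> : g z - g0 z = - ((1 - (1 + e1)^-1)%:C * g0 z).
    by rewrite /g rmorphB rmorph1 /=; ring.
  have i1 : 0 <= 1 - (1 + e1)^-1 by rewrite subr_ge0 invf_le1 // lerDl ltW.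
  rewrite nrmN nrmM nrm_real_ge0 //.
  apply: le_trans (ler_wpM2l i1 (g0le z z1)) _.
  by rewrite mulrBl mul1r mulVf ?gt_eqF // addrC addKr.
(* [am] keeps the dilated point within [2 * p.2] of the centre of its disc, [dm] preserves the far
   estimates, and [1 / 2] keeps [1 - t] positive. *)
pose t := Num.min (1 / 2) (Num.min dm am).
have t0 : 0 < t by rewrite !lt_min dm0 am0 divr_gt0.
have t2 : t <= 1 / 2 by rewrite ge_min lexx.
have tdm : t <= dm by rewrite !ge_min lexx orbT.
have tam : t <= am by rewrite !ge_min lexx !orbT.
clearbody t.
exists g, (1 - t); split => //; first by apply/andP; split; lra.
- move=> r /andP[r0 r1] z Kz.
  have zn : nrm z = 1 by apply/eqc1; exact: Kc.
  have r00 : 0 <= r by lra.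
  have rz1 : nrm (r%:C * z) < 1 by rewrite nrmM nrm_real_ge0 // zn mulr1.
  have rzz : nrm (r%:C * z - z) < t.
    have -> : r%:C * z - z = - ((1 - r)%:C * z).
      by rewrite rmorphB rmorph1 /=; ring.
    rewrite nrmN nrmM zn mulr1 nrm_real_ge0; lra.
  have near : nrm (g0 (r%:C * z) - phi z) <= 3 * e1.
    apply: wavg_near => //.
    - by move=> j; apply: w0; exact: ltW.
    - by move=> j; apply: w4; exact: ltW.
    - exact: f1.
    - exact: phi1.
    - move=> j js; have [d0 Hd] := Hdelta j (ssK j js).
      have [h|h] := ltP (nrm (z - j)) (4 * delta j).
        by left; rewrite nrmBC; exact: Hd.
      right; apply: w2 => [|p pa pj]; first exact: ltW.
      have := nrm_tri p.1 z j; have := nrm_tri (r%:C * z) z p.1.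
      rewrite [nrm (z - r%:C * z)]nrmBC.
      by have := Hdm j js; lra.
    - have [j js zj] := ssP z Kz; have [p pa zp] := arcs_cov z Kz.
      exists j => //; have [_ _ _ h] := W (r%:C * z) j (ltW rz1).
      apply: le_trans Hn _; rewrite ler_wpM2l ?(ltW e10) //; apply: h.
      rewrite -M9; apply: (Re_bump_sum_near M0 arcsP (ltW rz1) pa).
        have := nrm_tri z p.1 j; rewrite [nrm (p.1 - z)]nrmBC.
        by have := arcs_dm p pa; have := Hdm j js; lra.
      have := nrm_tri z (r%:C * z) p.1.
      by have := Ham p pa; lra.
  have := nrm_tri (g0 (r%:C * z)) (g (r%:C * z)) (phi z).
  by have := gg0 _ rz1; lra.
- move=> z zr; have z1 : nrm z < 1 by lra.
  have z1' := ltW z1.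
  have far : nrm (g0 z - f z) <= e1.
    apply: wavg_far => //.
    - by move=> j; exact: w0.
    - exact: f1.
    - move=> j js; apply: w2 => // p pa _.
      have [p1 _] := arcsP p pa.
      have := nrm_tri2 p.1 z; rewrite nrmBC p1; lra.
  have := nrm_tri (g0 z) (g z) (f z).
  by have := gg0 _ z1; lra.
Qed.

End BoundaryApprox.

(** * Supremum norms and the conclusion *)

Section SupNorm.
Variable R : realType.
Implicit Types (E : set R[i]^o) (h : R[i]^o -> R[i]^o).

Lemma supnorm_le1 E h : (supnorm E h <= 1)%E -> forall z, E z -> nrm (h z) <= 1.
Proof.
move=> h1 z Ez; rewrite -lee_fin; apply: le_trans h1.
by apply: ereal_sup_ubound; right; exists z.
Qed.

Lemma supnorm_lt E h (a b : R) : 0 <= a -> a < b ->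
  (forall z, E z -> nrm (h z) <= a) -> (supnorm E h < b%:E)%E.
Proof.
move=> a0 ab H; apply: (@le_lt_trans _ _ a%:E); last by rewrite lte_fin.
by apply: ge_ereal_sup => _ [->|[z Ez <-]]; rewrite lee_fin // H.
Qed.

Lemma compact_in_disc E : compact E -> E `<=` unit_disc R ->
  exists rho, [/\ 0 <= rho, rho < 1 & forall z, E z -> nrm z <= rho].
Proof.
move=> cE Ed; have [[z0 Ez0]|nE] := pselect (E !=set0); last first.
  by exists 0; split => // z Ez; case: nE; exists z.
have cn : {within E, continuous (fun z : R[i]^o => nrm z)}.
  by apply: continuous_subspaceT; exact: cts_nrm.
have [c cE' cmax] := compact_EVT_max (ex_intro _ z0 Ez0) cE cn.
rewrite inE in cE'; exists (nrm c); split; first exact: nrm_ge0.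
  by rewrite -ltc1; exact: Ed.
by move=> z Ez; apply: cmax; rewrite inE.
Qed.

End SupNorm.

Theorem theorem2p2 (R : realType) (K L : set R[i]^o)
    (phi f : R[i]^o -> R[i]^o) (eps : R)
    (cptK : compact K) (subK : K `<=` unit_circle R) (K0 : arclength K = 0%E)
    (cptL : compact L) (subL : L `<=` unit_disc R)
    (cphi : {within K, continuous phi}) (phi1 : (supnorm K phi <= 1)%E)
    (holf : holomorphic (unit_disc R) f)
    (f1 : (supnorm (unit_disc R) f <= 1)%E)
    (eps0 : 0 < eps) :
  exists r0 : R, 0 < r0 < 1 /\
    forall r : R, r0 < r < 1 ->
      exists B : R[i]^o -> R[i]^o,
        [/\ finite_blaschke_product B,
            (supnorm K (dilate r B \- phi)%R < eps%:E)%E &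
            (supnorm L (B \- f)%R < eps%:E)%E].
Proof.
have df z : nrm z < 1 -> derivable f z 1.
  by move=> z1; apply: holf; rewrite /unit_disc /= ltc1.
have Sf : schur [::] f.
  split; first by split=> z /df => [/derivable_cts|].
  by move=> z z1; apply: (supnorm_le1 f1); rewrite /unit_disc /= ltc1.
have [rho [rho0 rho1 Lrho]] := compact_in_disc cptL subL.
have e4 : 0 < eps / 4 by rewrite divr_gt0.
have e2 : 0 <= eps / 2 by rewrite divr_ge0 // ltW.
have e2e : eps / 2 < eps by lra.
have [g [r0 [Sg r01 gphi gf]]] :=
  schur_boundary_approx cptK subK K0 cphi (supnorm_le1 phi1) Sf rho0 rho1 e4.
exists r0; split => // r /andP[r0r r1].
have r00 : 0 <= r by move: r01 => /andP[? _]; lra.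
have m0 : 0 <= Num.max rho r by rewrite le_max rho0.
have m1 : Num.max rho r < 1 by rewrite gt_max rho1.
(* A single disc contains both [L] and the circle of radius [r], on which the dilate is evaluated.
   Each error is [eps / 4], so the suprema are at most [eps / 2] and the inequality is strict. *)
have [B HB Bg] := caratheodory_approx Sg m0 m1 e4.
exists B; split => //; apply: (supnorm_lt e2 e2e) => z Kz.
  have zn : nrm z = 1 by apply/eqc1; exact: subK.
  have zr : nrm (r%:C * z) <= Num.max rho r.
    by rewrite nrmM zn mulr1 nrm_real_ge0 // le_max lexx orbT.
  apply: le_trans (nrm_tri (g (r%:C * z)) _ _) _.
  have b1 := Bg _ zr; have b2 : nrm (g (r%:C * z) - phi z) <= eps / 4.
    by apply: gphi => //; rewrite r0r.
  by rewrite (_ : eps / 2 = eps / 4 + eps / 4) ?lerD //; field.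
have zr : nrm z <= Num.max rho r by rewrite le_max Lrho.
apply: le_trans (nrm_tri (g z) _ _) _.
by rewrite (_ : eps / 2 = eps / 4 + eps / 4) ?lerD ?Bg ?gf ?Lrho //; field.
Qed.
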